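(* Let $a>0$, let $\kappa\ge\tfrac12$ be real, let $p_1,p_2,r_{11},r_{12},r_{21},r_{22}\in C([0,a])$ be complex-valued with $p_1(0)\ne0$, let $\lambda\in\mathbb{C}$, and let $q\in C((0,a])$ be complex-valued with $|q(x)|\le c_qx^\alpha$ for $x\in(0,a]$, for some $c_q>0$ and some $-1<\alpha\le0$. Let $(f_q,g_q)$ be the solution of the homogeneous system $$v'+p_1u+\Big(\frac{\kappa}{x}+q\Big)v=0,\qquad -u'+\Big(\frac{\kappa}{x}+q\Big)u+p_2v=0,\qquad x\in(0,a],$$ given by $$\begin{pmatrix}f_q\\ g_q\end{pmatrix}=\sum_{n=0}^\infty\frac1{n!}\begin{pmatrix}\widehat X_q^{(n)}\\ \widehat Y_q^{(n)}\end{pmatrix},$$ with $\widehat X_q^{(n)},\widehat Y_q^{(n)}$ defined in the context. Assume that $f_q$ does not vanish except at $x=0$ (i.e. $f_q(x)\neq0$ for all $x\in(0,a]$). Let $\widehat X^{(n)},\widehat Y^{(n)}$ be the formal powers constructed from $(f,g)=(f_q,g_q)$ as defined in the context. Then the regular solution (in the sense defined in the context) of the system $$v'+p_1u+\Big(\frac{\kappa}{x}+q\Big)v=\lambda(r_{11}u+r_{12}v),\qquad -u'+\Big(\frac{\kappa}{x}+q\Big)u+p_2v=\lambda(r_{21}u+r_{22}v),\qquad x\in(0,a],$$ is given by the (convergent) series $$\begin{pmatrix}u\\ v\end{pmatrix}=\sum_{n=0}^\infty\frac{\lambda^n}{n!}\begin{pmatrix}\widehat X^{(n)}\\ \widehat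 Y^{(n)}\end{pmatrix}.$$
   Context: Functions $\widehat X_q^{(n)},\widehat Y_q^{(n)}$: put $f_0(x)=x^\kappa$, $g_0(x)=-x^{-\kappa}\int_0^xt^{2\kappa}p_1(t)\,dt$, $\widehat X_q^{(0)}=f_0$, $\widehat Y_q^{(0)}=g_0$, and for $n\ge0$, $$\widehat Z_q^{(n)}(x)=\int_0^x\Big(-\widehat X_q^{(n)}(t)g_0(t)q(t)+\widehat Y_q^{(n)}(t)\big(-f_0(t)q(t)-g_0(t)p_2(t)\big)\Big)dt,$$ $$\widehat X_q^{(n+1)}(x)=(n+1)f_0(x)\int_0^x\Big(\frac{q(t)}{f_0(t)}\widehat X_q^{(n)}(t)+\frac{p_2(t)}{f_0(t)}\widehat Y_q^{(n)}(t)\Big)dt,$$ $$\widehat Y_q^{(n+1)}(x)=(n+1)\frac1{f_0(x)}\widehat Z_q^{(n)}(x)+\frac{g_0(x)}{f_0(x)}\widehat X_q^{(n+1)}(x).$$ Formal powers constructed from $(f,g)$: $\widehat X^{(0)}=f$, $\widehat Y^{(0)}=g$, and for $n\ge0$, $$\widehat Z^{(n)}(x)=\int_0^x\Big(\widehat X^{(n)}(t)\big(f(t)r_{11}(t)+g(t)r_{21}(t)\big)+\widehat Y^{(n)}(t)\big(f(t)r_{12}(t)+g(t)r_{22}(t)\big)\Big)dt,$$ $$\widehat X^{(n+1)}(x)=(n+1)f(x)\int_0^x\Big(-\frac{r_{21}(t)}{f(t)}\widehat X^{(n)}(t)-\frac{r_{22}(t)}{f(t)}\widehat Y^{(n)}(t)+\frac{p_2(t)}{f^2(t)}\widehat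 Z^{(n)}(t)\Big)dt,$$ $$\widehat Y^{(n+1)}(x)=(n+1)\frac{1}{f(x)}\widehat Z^{(n)}(x)+\frac{g(x)}{f(x)}\widehat X^{(n+1)}(x).$$ Regular solution: a solution $(u,v)$ on $(0,a]$ of the system with parameter $\lambda$ such that $u$ and $v$ are bounded at the origin and, as $x\to0$, $$u(x)\sim x^\kappa,\quad u'(x)\sim\kappa x^{\kappa-1},\quad v(x)\sim\mu x^{\kappa+1},\quad v'(x)\sim\mu(\kappa+1)x^\kappa,\qquad \mu=\mu(\lambda)=\frac{\lambda r_{11}(0)-p_1(0)}{2\kappa+1}.$$ If $\mu=0$, the asymptotic relation for $v$ is to be read as $v(x)=o(x^{\kappa+1})$. Here $f_1(x)\sim f_2(x)$, $x\to0$, means $f_1(x)=f_2(x)[1+o(1)]$ as $x\to0$. Solutions are functions continuously differentiable on $(0,a]$. *)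

(* Defs.v *)
(* Functions on the intervals (0,a] and [0,a] are total functions R -> C whose
   values outside the interval are never used. *)
From Stdlib Require Import Reals Factorial.
From Coquelicot Require Import Coquelicot.

Local Open Scope C_scope.

Definition Ioc (a : R) (x : R) : Prop := (0 < x <= a)%R.
Definition Icc (a : R) (x : R) : Prop := (0 <= x <= a)%R.

Definition cont_on (D : R -> Prop) (f : R -> C) : Prop :=
  continuous_on (U := C_UniformSpace) D f.

(* Derivative relative to [D], hence one-sided at an endpoint of [D]. *)
Definition is_derive_on (D : R -> Prop) (f : R -> C) (x : R) (l : C) : Prop :=
  filterdiff (K := R_AbsRing) (U := R_NormedModule) (V := C_R_NormedModule)
    f (within D (locally x))
    (fun y : R => scal (V := C_R_NormedModule) y l).

Definition C1_on (D : R -> Prop) (f df : R -> C) : Prop :=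
  (forall x, D x -> is_derive_on D f x (df x)) /\ cont_on D df.

(* The integral from 0 to x, improper at 0: [q] may be singular there, and
   [Rpower 0 y] is a junk value. *)
Definition int0 (h : R -> C) (x : R) : C :=
  RInt_gen (V := C_R_CompleteNormedModule) h (at_right 0) (at_point x).

Definition CSeries (t : nat -> C) : C :=
  (Series (fun n => Re (t n)), Series (fun n => Im (t n))).

Definition is_Cseries (t : nat -> C) (s : C) : Prop :=
  is_series (V := C_R_NormedModule) t s.

(* x^y, for x > 0 (exponent first). *)
Definition rpow (y x : R) : C := RtoC (Rpower x y).

(* f1(x) = f2(x) [1 + o(1)] as x -> 0+. *)
Definition asymp (f1 f2 : R -> C) : Prop :=
  exists e : R -> C,
    filterlim e (at_right 0) (locally (T := C_UniformSpace) (RtoC 0)) /\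
    at_right 0 (fun x => f1 x = f2 x * (1 + e x)).

Definition little_o (f1 f2 : R -> C) : Prop :=
  exists e : R -> C,
    filterlim e (at_right 0) (locally (T := C_UniformSpace) (RtoC 0)) /\
    at_right 0 (fun x => f1 x = f2 x * e x).

Definition bounded_at_0 (h : R -> C) : Prop :=
  exists M : R, at_right 0 (fun x => (Cmod (h x) <= M)%R).

Definition f0 (kappa : R) : R -> C := rpow kappa.

Definition g0 (kappa : R) (p1 : R -> C) (x : R) : C :=
  - rpow (- kappa) x * int0 (fun t => rpow (2 * kappa) t * p1 t) x.

(* These are the formal powers [XY] below, constructed from (f0, g0), with
   r11 = 0, r12 = r21 = - q, r22 = - p2 and with 0 in place of p2. *)
Fixpoint XYq (kappa : R) (p1 p2 q : R -> C) (n : nat) : (R -> C) * (R -> C) :=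
  let f0 := f0 kappa in
  let g0 := g0 kappa p1 in
  match n with
  | O => (f0, g0)
  | S m =>
      let (X, Y) := XYq kappa p1 p2 q m in
      let Z := int0 (fun t =>
        - X t * g0 t * q t + Y t * (- f0 t * q t - g0 t * p2 t)) in
      let X' := fun x =>
        RtoC (INR (S m)) * f0 x *
        int0 (fun t => q t / f0 t * X t + p2 t / f0 t * Y t) x in
      let Y' := fun x =>
        RtoC (INR (S m)) * (1 / f0 x) * Z x + g0 x / f0 x * X' x in
      (X', Y')
  end.

Definition Xq kappa p1 p2 q n := fst (XYq kappa p1 p2 q n).
Definition Yq kappa p1 p2 q n := snd (XYq kappa p1 p2 q n).

Definition fq kappa p1 p2 q (x : R) : C :=
  CSeries (fun n => / RtoC (INR (fact n)) * Xq kappa p1 p2 q n x).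
Definition gq kappa p1 p2 q (x : R) : C :=
  CSeries (fun n => / RtoC (INR (fact n)) * Yq kappa p1 p2 q n x).

Fixpoint XY (f g p2 r11 r12 r21 r22 : R -> C) (n : nat)
  : (R -> C) * (R -> C) :=
  match n with
  | O => (f, g)
  | S m =>
      let (X, Y) := XY f g p2 r11 r12 r21 r22 m in
      let Z := int0 (fun t =>
        X t * (f t * r11 t + g t * r21 t) +
        Y t * (f t * r12 t + g t * r22 t)) in
      let X' := fun x =>
        RtoC (INR (S m)) * f x *
        int0 (fun t =>
          - (r21 t / f t) * X t - r22 t / f t * Y t
          + p2 t / (f t * f t) * Z t) x in
      let Y' := fun x =>
        RtoC (INR (S m)) * (1 / f x) * Z x + g x / f x * X' x in
      (X', Y')
  end.

Definition Xpow f g p2 r11 r12 r21 r22 n := fst (XY f g p2 r11 r12 r21 r22 n).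
Definition Ypow f g p2 r11 r12 r21 r22 n := snd (XY f g p2 r11 r12 r21 r22 n).

Definition solves_homogeneous (a kappa : R) (p1 p2 q u v : R -> C) : Prop :=
  exists du dv : R -> C,
    C1_on (Ioc a) u du /\ C1_on (Ioc a) v dv /\
    forall x, Ioc a x ->
      dv x + p1 x * u x + (RtoC (kappa / x) + q x) * v x = 0 /\
      - du x + (RtoC (kappa / x) + q x) * u x + p2 x * v x = 0.

Definition solves_system (a kappa : R) (p1 p2 q r11 r12 r21 r22 : R -> C)
    (lambda : C) (u v du dv : R -> C) : Prop :=
  C1_on (Ioc a) u du /\ C1_on (Ioc a) v dv /\
  forall x, Ioc a x ->
    dv x + p1 x * u x + (RtoC (kappa / x) + q x) * v x
      = lambda * (r11 x * u x + r12 x * v x) /\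
    - du x + (RtoC (kappa / x) + q x) * u x + p2 x * v x
      = lambda * (r21 x * u x + r22 x * v x).

Definition mu (kappa : R) (p1 r11 : R -> C) (lambda : C) : C :=
  (lambda * r11 0%R - p1 0%R) / RtoC (2 * kappa + 1).

(* For mu = 0 the relations v ~ mu x^(kappa+1) and v' ~ mu (kappa+1) x^kappa
   are read as v = o(x^(kappa+1)) and v' = o(x^kappa). *)
Definition regular_solution (a kappa : R) (p1 p2 q r11 r12 r21 r22 : R -> C)
    (lambda : C) (u v : R -> C) : Prop :=
  let m := mu kappa p1 r11 lambda in
  exists du dv : R -> C,
    solves_system a kappa p1 p2 q r11 r12 r21 r22 lambda u v du dv /\
    bounded_at_0 u /\ bounded_at_0 v /\
    asymp u (rpow kappa) /\
    asymp du (fun x => RtoC kappa * rpow (kappa - 1) x) /\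
    (m <> 0 ->
      asymp v (fun x => m * rpow (kappa + 1) x) /\
      asymp dv (fun x => m * RtoC (kappa + 1) * rpow kappa x)) /\
    (m = 0 ->
      little_o v (rpow (kappa + 1)) /\ little_o dv (rpow kappa)).

(* Main.v *)
(* The perturbed solution is written u = f + lambda T(u, v)_1, v = g + lambda T(u, v)_2 with
   the Volterra operator T obtained by variation of constants from the homogeneous
   solution (f, g); iterating gives the formal powers, X^(n) = n! T^n(f, g)_1 and
   likewise Y^(n).  If f and 1/f are comparable to x^kappa and x^(-kappa), and
   g = O(x^kappa), then T maps O(x^kappa h^n/n!) to O(x^kappa h^(n+1)/(n+1)!) with
   h = x^(alpha+1)/(alpha+1), even when all coefficients of the perturbation are only
   O(x^alpha).  Hence the series converges, u - f = O(x^(kappa+alpha+1)) and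
   v = O(x^kappa).  This is used twice: from (f0, g0), where the perturbation is
   (q, p2), to get (f_q, g_q), and then from (f_q, g_q).

   The sharp asymptotics of v come from the equation for W = x^kappa v, which gives first
   W = O(x^(2 kappa+1)) and then W ~ mu x^(2 kappa+1).  For uniqueness the difference of
   two regular solutions, divided by x^kappa, satisfies a homogeneous Volterra inequality
   with integrable weight x^alpha. *)

Require Import Defs.
From Stdlib Require Import Reals Factorial Lra Lia FunctionalExtensionality.
From Coquelicot Require Import Coquelicot.

Local Open Scope C_scope.

(** * Complex-valued limits and continuity *)

(** Two obstacles shape the proof. Termwise differentiation would need uniform convergence of the
    derivatives, whose coefficients blow up at 0. It is avoided: the sum satisfies u = f + lambda
    T(u, v)_1 and v = g + lambda T(u, v)_2, and these right-hand sides are differentiable because T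
    is built from integrals. Moreover, every integral starts at the singular endpoint; so only
    primitives tending to 0 at 0 are used, and estimates come from a mean value inequality against
    an explicit majorant. Both components are measured in the weight x^kappa, although v is really
    O(x^(kappa+1)): one common weight gives a single scalar recursion, and the lost power of x is
    recovered afterwards from the first-order equation of v, in which u is already known. In the
    second use the bound of 1/f by x^(-kappa) is not explicit: it follows from f / x^kappa -> 1 near
    0 and, away from 0, from compactness and the absence of zeros. *)

Lemma filterlim_C_iff (T : Type) (F : (T -> Prop) -> Prop) (f : T -> C) (l : C) :
  Filter F ->
  filterlim f F (locally (T := C_UniformSpace) l) <->
  forall eps : R, (0 < eps)%R -> F (fun x => (Cmod (f x - l) < eps)%R).
Proof.
  intros FF; split.
  - intros H eps Heps.
    (* Balls of [C_UniformSpace] are squares, and [Cmod] is at most sqrt 2 < 2 times the larger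
       component; hence half of eps is asked of each component. *)
    assert (H2 : (0 < eps / 2)%R) by lra.
    generalize (proj1 (filterlim_locally (U := C_UniformSpace) f l) H (mkposreal _ H2)).
    apply filter_imp; intros x [H3 H4].
    change (Rabs (fst (f x) - fst l) < eps / 2)%R in H3.
    change (Rabs (snd (f x) - snd l) < eps / 2)%R in H4.
    apply Rle_lt_trans with (1 := Cmod_2Rmax _).
    assert (Hs : (sqrt 2 < 2)%R).
    { rewrite <- (sqrt_Rsqr 2) at 2 by lra. apply sqrt_lt_1; unfold Rsqr; lra. }
    assert (Hm : (Rmax (Rabs (fst (f x - l)%C)) (Rabs (snd (f x - l)%C)) < eps / 2)%R).
    { apply Rmax_lub_lt; assumption. }
    assert (0 <= Rmax (Rabs (fst (f x - l)%C)) (Rabs (snd (f x - l)%C)))%R.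
    { apply Rle_trans with (2 := Rmax_l _ _). apply Rabs_pos. }
    nra.
  - intros H. apply (filterlim_locally (U := C_UniformSpace)). intros eps.
    generalize (H eps (cond_pos eps)). apply filter_imp; intros x Hx.
    split.
    + apply Rle_lt_trans with (2 := Hx). apply Rle_trans with (2 := Rmax_Cmod _).
      apply Rmax_l.
    + apply Rle_lt_trans with (2 := Hx). apply Rle_trans with (2 := Rmax_Cmod _).
      apply Rmax_r.
Qed.

Section Limits.
Context {T : Type} (F : (T -> Prop) -> Prop) {FF : Filter F}.

Lemma filterlim_Cplus (f g : T -> C) (l m : C) :
  filterlim f F (locally (T := C_UniformSpace) l) ->
  filterlim g F (locally (T := C_UniformSpace) m) ->
  filterlim (fun x => f x + g x) F (locally (T := C_UniformSpace) (l + m)).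
Proof.
  rewrite !filterlim_C_iff by assumption. intros Hf Hg eps He.
  assert (He2 : (0 < eps / 2)%R) by lra.
  generalize (filter_and _ _ (Hf _ He2) (Hg _ He2)).
  apply filter_imp; intros x [H1 H2].
  replace (f x + g x - (l + m)) with ((f x - l) + (g x - m)) by ring.
  apply Rle_lt_trans with (1 := Cmod_triangle _ _). lra.
Qed.

Lemma filterlim_Cmult (f g : T -> C) (l m : C) :
  filterlim f F (locally (T := C_UniformSpace) l) ->
  filterlim g F (locally (T := C_UniformSpace) m) ->
  filterlim (fun x => f x * g x) F (locally (T := C_UniformSpace) (l * m)).
Proof.
  rewrite !filterlim_C_iff by assumption. intros Hf Hg eps He.
  set (K := (1 + Cmod l + Cmod m)%R).
  assert (HK : (1 <= K)%R) by (unfold K; generalize (Cmod_ge_0 l) (Cmod_ge_0 m); lra).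
  set (d := Rmin 1 (eps / K)).
  assert (Hd1 : (d <= 1)%R) by apply Rmin_l.
  assert (HdK : (d * K <= eps)%R).
  { apply Rle_trans with (eps / K * K)%R.
    - apply Rmult_le_compat_r; [lra | apply Rmin_r].
    - right; field; lra. }
  assert (Hd : (0 < d)%R).
  { apply Rmin_glb_lt; [lra |]. apply Rdiv_lt_0_compat; lra. }
  generalize (filter_and _ _ (Hf d Hd) (Hg d Hd)).
  apply filter_imp; intros x [H1 H2].
  replace (f x * g x - l * m)
    with ((f x - l) * (g x - m) + (l * (g x - m) + (f x - l) * m)) by ring.
  apply Rle_lt_trans with (1 := Cmod_triangle _ _).
  apply Rle_lt_trans with (1 := Rplus_le_compat_l _ _ _ (Cmod_triangle _ _)).
  rewrite !Cmod_mult.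
  generalize (Cmod_ge_0 (f x - l)) (Cmod_ge_0 (g x - m)) (Cmod_ge_0 l) (Cmod_ge_0 m).
  intros A1 A2 A3 A4. unfold K in HdK.
  apply Rlt_le_trans with (2 := HdK).
  assert (Cmod (f x - l) * Cmod (g x - m) < d * 1)%R.
  { apply Rle_lt_trans with (Cmod (f x - l) * 1)%R.
    - apply Rmult_le_compat_l; lra.
    - lra. }
  assert (Cmod l * Cmod (g x - m) <= Cmod l * d)%R by (apply Rmult_le_compat_l; lra).
  assert (Cmod (f x - l) * Cmod m <= d * Cmod m)%R by (apply Rmult_le_compat_r; lra).
  lra.
Qed.

Lemma filterlim_Cinv (f : T -> C) (l : C) :
  l <> 0 ->
  filterlim f F (locally (T := C_UniformSpace) l) ->
  filterlim (fun x => / f x) F (locally (T := C_UniformSpace) (/ l)).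
Proof.
  rewrite !filterlim_C_iff by assumption. intros Hl Hf eps He.
  assert (HL : (0 < Cmod l)%R) by now apply Cmod_gt_0.
  set (L := Cmod l) in *.
  assert (E1 : (0 < L / 2)%R) by lra.
  assert (E2 : (0 < eps * L * L / 2)%R).
  { apply Rdiv_lt_0_compat; [|lra]. repeat apply Rmult_lt_0_compat; lra. }
  generalize (filter_and _ _ (Hf _ E1) (Hf _ E2)).
  apply filter_imp; intros x [H1 H2].
  assert (Hfx : (L / 2 < Cmod (f x))%R).
  { assert (L <= Cmod (f x) + Cmod (f x - l))%R.
    { unfold L. replace l with (f x + - (f x - l)) at 1 by ring.
      rewrite <- (Cmod_opp (f x - l)). apply Cmod_triangle. }
    lra. }
  assert (Hf0 : f x <> 0) by (apply Cmod_gt_0; lra).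
  replace (/ f x - / l) with (- (f x - l) / (f x * l)) by (field; auto).
  rewrite Cmod_div by (apply Cmult_neq_0; auto).
  rewrite Cmod_opp, Cmod_mult. fold L.
  apply Rmult_lt_reg_r with (Cmod (f x) * L)%R.
  { apply Rmult_lt_0_compat; lra. }
  unfold Rdiv. rewrite Rmult_assoc, Rinv_l by (apply Rgt_not_eq, Rmult_lt_0_compat; lra).
  rewrite Rmult_1_r. apply Rlt_trans with (1 := H2).
  assert (eps * L * (L / 2) < eps * L * Cmod (f x))%R.
  { apply Rmult_lt_compat_l; [apply Rmult_lt_0_compat; lra | lra]. }
  lra.
Qed.

Lemma filterlim_Copp (f : T -> C) (l : C) :
  filterlim f F (locally (T := C_UniformSpace) l) ->
  filterlim (fun x => - f x) F (locally (T := C_UniformSpace) (- l)).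
Proof.
  rewrite !filterlim_C_iff by assumption. intros Hf eps He.
  generalize (Hf eps He). apply filter_imp; intros x Hx.
  replace (- f x - - l) with (- (f x - l)) by ring. now rewrite Cmod_opp.
Qed.

Lemma filterlim_RtoC (f : T -> R) (l : R) :
  filterlim f F (locally l) ->
  filterlim (fun x => RtoC (f x)) F (locally (T := C_UniformSpace) (RtoC l)).
Proof.
  intros H. rewrite filterlim_C_iff by assumption. intros eps He.
  generalize (proj1 (filterlim_locally f l) H (mkposreal _ He)).
  apply filter_imp; intros x Hx. now rewrite <- RtoC_minus, Cmod_R.
Qed.

End Limits.

Section ContOn.
Variable D : R -> Prop.

Lemma cont_on_ext (f g : R -> C) :
  (forall x, D x -> f x = g x) -> cont_on D f -> cont_on D g.
Proof.
  intros E H x Hx. rewrite <- (E x Hx).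
  apply (filterlim_within_ext D f); auto.
Qed.

Lemma cont_on_const (c : C) : cont_on D (fun _ => c).
Proof. intros x Hx. apply filterlim_const. Qed.

Lemma cont_on_plus (f g : R -> C) :
  cont_on D f -> cont_on D g -> cont_on D (fun x => f x + g x).
Proof.
  intros Hf Hg x Hx.
  apply filterlim_Cplus; [typeclasses eauto | exact (Hf x Hx) | exact (Hg x Hx)].
Qed.

Lemma cont_on_mult (f g : R -> C) :
  cont_on D f -> cont_on D g -> cont_on D (fun x => f x * g x).
Proof.
  intros Hf Hg x Hx.
  apply filterlim_Cmult; [typeclasses eauto | exact (Hf x Hx) | exact (Hg x Hx)].
Qed.

Lemma cont_on_opp (f : R -> C) : cont_on D f -> cont_on D (fun x => - f x).
Proof.
  intros Hf x Hx.
  apply filterlim_Copp; [typeclasses eauto | exact (Hf x Hx)].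
Qed.

Lemma cont_on_minus (f g : R -> C) :
  cont_on D f -> cont_on D g -> cont_on D (fun x => f x - g x).
Proof. intros Hf Hg. apply cont_on_plus; auto. now apply cont_on_opp. Qed.

Lemma cont_on_inv (f : R -> C) :
  (forall x, D x -> f x <> 0) -> cont_on D f -> cont_on D (fun x => / f x).
Proof.
  intros Hn Hf x Hx.
  apply filterlim_Cinv; [typeclasses eauto | exact (Hn x Hx) | exact (Hf x Hx)].
Qed.

Lemma cont_on_div (f g : R -> C) :
  (forall x, D x -> g x <> 0) -> cont_on D f -> cont_on D g ->
  cont_on D (fun x => f x / g x).
Proof. intros Hn Hf Hg. apply cont_on_mult; auto. now apply cont_on_inv. Qed.

Lemma cont_on_RtoC (f : R -> R) :
  (forall x, D x -> continuous f x) -> cont_on D (fun x => RtoC (f x)).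
Proof.
  intros H x Hx. apply filterlim_RtoC; [typeclasses eauto |].
  apply filterlim_filter_le_1 with (2 := H x Hx). intros P. apply filter_le_within.
Qed.

Lemma cont_on_subset (E : R -> Prop) (f : R -> C) :
  (forall x, E x -> D x) -> cont_on D f -> cont_on E f.
Proof.
  intros S H x Hx. apply filterlim_filter_le_1 with (2 := H x (S x Hx)).
  intros P. unfold within. apply filter_imp. auto.
Qed.

(** [filterdiff] quantifies over all limits of the filter. Since [D x] holds, [within D (locally x)]
    is proper and x is its only limit, so the definition reduces to one estimate. *)
Lemma is_derive_on_iff (f : R -> C) (x : R) (l : C) :
  D x ->
  is_derive_on D f x l <->
  forall eps : R, (0 < eps)%R ->
    within D (locally x)
      (fun y => (Cmod (f y - f x - RtoC (y - x) * l) <= eps * Rabs (y - x))%R).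
Proof.
  intros Dx.
  assert (N : forall y, norm (minus (minus (f y) (f x)) (scal (minus y x) l)
                         : C_R_NormedModule)
              = Cmod (f y - f x - RtoC (y - x) * l)).
  { intros y. rewrite <- Cmod_norm. f_equal.
    unfold minus, plus, opp, scal; simpl.
    unfold prod_plus, prod_opp, prod_scal; simpl.
    unfold plus, opp, scal, mult; simpl. unfold mult; simpl.
    destruct (f y), (f x), l. unfold Cminus, Cplus, Copp, Cmult, RtoC; simpl.
    f_equal; ring. }
  split.
  - intros [_ H] eps He.
    assert (Hx : is_filter_lim (within D (locally x)) x).
    { intros P HP. now apply filter_le_within. }
    generalize (H x Hx (mkposreal _ He)). apply filter_imp.
    intros y Hy. rewrite <- N. exact Hy.
  - intros H. split; [apply is_linear_scal_l |].
    intros x' Hx' eps.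
    assert (x' = x).
    { symmetry. apply (@is_filter_lim_unique R_AbsRing R_NormedModule (within D (locally x))); auto.
      - constructor.
        + intros HF. destruct HF as [e He]. apply (He x); auto. apply ball_center.
        + typeclasses eauto.
      - intros P HP. now apply filter_le_within. }
    subst x'.
    generalize (H eps (cond_pos eps)). apply filter_imp.
    intros y Hy. rewrite <- N in Hy. exact Hy.
Qed.

End ContOn.

(** * One-sided derivatives *)

Section DeriveOn.
Variable D : R -> Prop.

(** In slope form the rules for sums, products and inverses reduce to limit rules in C. The filter
    omits x itself, where the quotient is a junk value. *)
Lemma is_derive_on_slope (f : R -> C) (x : R) (l : C) :
  D x ->
  is_derive_on D f x l <->
  filterlim (fun y => (f y - f x) / RtoC (y - x))
    (within (fun y => D y /\ y <> x) (locally x)) (locally (T := C_UniformSpace) l).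
Proof.
  intros Dx. rewrite is_derive_on_iff, filterlim_C_iff by (assumption || typeclasses eauto).
  assert (E : forall y, y <> x ->
    Cmod (f y - f x - RtoC (y - x) * l)
    = (Cmod ((f y - f x) / RtoC (y - x) - l) * Rabs (y - x))%R).
  { intros y Hy. rewrite <- Cmod_R, <- Cmod_mult. f_equal. field.
    intros K. apply Hy, Rminus_diag_uniq, RtoC_inj, K. }
  split; intros H eps He.
  - assert (He2 : (0 < eps / 2)%R) by lra.
    generalize (H _ He2). unfold within. apply filter_imp.
    intros y Hy [Dy Ny]. specialize (Hy Dy). rewrite (E y Ny) in Hy.
    apply Rmult_le_reg_r in Hy; [lra |].
    apply Rabs_pos_lt. lra.
  - generalize (H _ He). unfold within. apply filter_imp.
    intros y Hy Dy. destruct (Req_dec y x) as [-> | Ny].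
    + rewrite Rminus_diag, Rabs_R0, Rmult_0_r.
      replace (f x - f x - 0%R * l) with (RtoC 0) by ring.
      rewrite Cmod_0. apply Rle_refl.
    + rewrite (E y Ny). apply Rmult_le_compat_r; [apply Rabs_pos |].
      left. auto.
Qed.

Lemma is_derive_on_cont (f : R -> C) (x : R) (l : C) :
  D x -> is_derive_on D f x l ->
  filterlim f (within D (locally x)) (locally (T := C_UniformSpace) (f x)).
Proof.
  intros Dx H. rewrite is_derive_on_iff in H by assumption.
  rewrite filterlim_C_iff by typeclasses eauto. intros eps He.
  set (K := (1 + Cmod l)%R).
  assert (HK : (0 < K)%R) by (generalize (Cmod_ge_0 l); unfold K; lra).
  assert (Hd : (0 < eps / K)%R) by now apply Rdiv_lt_0_compat.
  assert (HB : within D (locally x) (fun y => (Rabs (y - x) < eps / K)%R)).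
  { apply filter_le_within. exists (mkposreal _ Hd). intros y Hy. exact Hy. }
  generalize (filter_and _ _ (H 1%R Rlt_0_1) HB). apply filter_imp.
  intros y [H1 H2].
  replace (f y - f x) with ((f y - f x - RtoC (y - x) * l) + RtoC (y - x) * l) by ring.
  apply Rle_lt_trans with (1 := Cmod_triangle _ _).
  rewrite Cmod_mult, Cmod_R.
  apply Rle_lt_trans with (Rabs (y - x) * K)%R; [unfold K; lra |].
  apply Rlt_le_trans with (eps / K * K)%R.
  - now apply Rmult_lt_compat_r.
  - right; field; lra.
Qed.

Lemma is_derive_on_cont_on (f df : R -> C) :
  (forall x, D x -> is_derive_on D f x (df x)) -> cont_on D f.
Proof. intros H x Hx. now apply is_derive_on_cont with (df x), H. Qed.

Lemma is_derive_on_ext (f g : R -> C) (x : R) (l : C) :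
  (forall y, D y -> f y = g y) -> D x ->
  is_derive_on D f x l -> is_derive_on D g x l.
Proof.
  intros E Dx. rewrite !is_derive_on_iff by assumption. intros H eps He.
  generalize (H eps He). unfold within. apply filter_imp.
  intros y Hy Dy. rewrite <- (E y Dy), <- (E x Dx). auto.
Qed.

Lemma is_derive_on_const (c : C) (x : R) : D x -> is_derive_on D (fun _ => c) x 0.
Proof.
  intros Dx. rewrite is_derive_on_iff by assumption. intros eps He.
  apply filter_forall. intros y.
  replace (c - c - RtoC (y - x) * 0) with (RtoC 0) by ring. rewrite Cmod_0.
  apply Rmult_le_pos; [lra | apply Rabs_pos].
Qed.

Lemma is_derive_on_plus (f g : R -> C) (x : R) (l m : C) :
  D x -> is_derive_on D f x l -> is_derive_on D g x m ->
  is_derive_on D (fun y => f y + g y) x (l + m).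
Proof.
  intros Dx. rewrite !is_derive_on_slope by assumption. intros Hf Hg.
  apply filterlim_ext with
    (fun y => (f y - f x) / RtoC (y - x) + (g y - g x) / RtoC (y - x)).
  - intros y. unfold Cdiv. ring.
  - apply filterlim_Cplus; [typeclasses eauto | exact Hf | exact Hg].
Qed.

Lemma is_derive_on_mult (f g : R -> C) (x : R) (l m : C) :
  D x -> is_derive_on D f x l -> is_derive_on D g x m ->
  is_derive_on D (fun y => f y * g y) x (l * g x + f x * m).
Proof.
  intros Dx Hf Hg.
  assert (Cg := is_derive_on_cont _ _ _ Dx Hg). revert Hf Hg.
  rewrite !is_derive_on_slope by assumption. intros Hf Hg.
  apply filterlim_ext with
    (fun y => (f y - f x) / RtoC (y - x) * g y + f x * ((g y - g x) / RtoC (y - x))).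
  - intros y. unfold Cdiv. ring.
  - apply filterlim_Cplus; [typeclasses eauto | |];
      (apply filterlim_Cmult; [typeclasses eauto | |]).
    + exact Hf.
    + apply filterlim_filter_le_1 with (2 := Cg).
      intros P. unfold within. apply filter_imp. tauto.
    + apply filterlim_const.
    + exact Hg.
Qed.

Lemma is_derive_on_inv (f : R -> C) (x : R) (l : C) :
  (forall y, D y -> f y <> 0) -> D x -> is_derive_on D f x l ->
  is_derive_on D (fun y => / f y) x (- l / (f x * f x)).
Proof.
  intros Nf Dx Hf.
  assert (Cf := is_derive_on_cont _ _ _ Dx Hf). revert Hf.
  rewrite !is_derive_on_slope by assumption. intros Hf.
  apply filterlim_within_ext with
    (fun y => (- ((f y - f x) / RtoC (y - x))) * / (f y * f x)).
  - intros y [Dy Ny]. field. repeat split; auto.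
    intros K. apply Ny, Rminus_diag_uniq, RtoC_inj, K.
  - apply filterlim_Cmult; [typeclasses eauto | |].
    + apply filterlim_Copp; [typeclasses eauto | exact Hf].
    + apply filterlim_Cinv; [typeclasses eauto | apply Cmult_neq_0; auto |].
      apply filterlim_Cmult; [typeclasses eauto | | apply filterlim_const].
      apply filterlim_filter_le_1 with (2 := Cf).
      intros P. unfold within. apply filter_imp. tauto.
Qed.

Lemma is_derive_on_scal (c : C) (f : R -> C) (x : R) (l : C) :
  D x -> is_derive_on D f x l -> is_derive_on D (fun y => c * f y) x (c * l).
Proof.
  intros Dx H. replace (c * l) with (0 * f x + c * l) by ring.
  apply is_derive_on_mult; auto. now apply is_derive_on_const.
Qed.

Lemma is_derive_on_minus (f g : R -> C) (x : R) (l m : C) :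
  D x -> is_derive_on D f x l -> is_derive_on D g x m ->
  is_derive_on D (fun y => f y - g y) x (l - m).
Proof.
  intros Dx Hf Hg. replace (l - m) with (l + (- (1)) * m) by ring.
  apply is_derive_on_ext with (fun y => f y + (- (1)) * g y); auto.
  - intros; ring.
  - apply is_derive_on_plus; auto. now apply is_derive_on_scal.
Qed.

Lemma is_derive_is_derive_on (f : R -> C) (x : R) (l : C) :
  D x -> is_derive (V := C_R_NormedModule) f x l -> is_derive_on D f x l.
Proof.
  intros Dx [_ H]. rewrite is_derive_on_iff by assumption. intros eps He.
  apply filter_le_within.
  generalize (proj1 (is_derive_on_iff (fun _ => True) f x l I)). intros K.
  assert (Q : is_derive_on (fun _ => True) f x l).
  { split; [apply is_linear_scal_l |]. intros x' Hx'.
    apply (is_domin_le (F := locally x)).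
    - apply H. intros P HP. generalize (Hx' P HP). unfold within. apply filter_imp. tauto.
    - apply filter_le_within. }
  generalize (K Q eps He). unfold within. apply filter_imp. tauto.
Qed.

Lemma is_derive_on_RtoC (f : R -> R) (x l : R) :
  D x -> is_derive f x l -> is_derive_on D (fun t => RtoC (f t)) x (RtoC l).
Proof.
  intros Dx [_ H]. rewrite is_derive_on_iff by assumption. intros eps He.
  apply filter_le_within.
  generalize (H x (fun P HP => HP) (mkposreal _ He)). apply filter_imp.
  intros y Hy. rewrite <- RtoC_mult, <- !RtoC_minus, Cmod_R. exact Hy.
Qed.

(** Gives access to the real mean value theorem. The resulting derivative is two-sided, hence x has
    to be interior to D. *)
Lemma is_derive_on_Re (f : R -> C) (x : R) (l : C) :
  locally x D -> is_derive_on D f x l -> is_derive (fun t => Re (f t)) x (Re l).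
Proof.
  intros HD H. assert (Dx := locally_singleton _ _ HD).
  rewrite is_derive_on_iff in H by assumption.
  split; [apply is_linear_scal_l |]. intros x' Hx'.
  assert (x = x') by now apply (@is_filter_lim_locally_unique R_AbsRing R_NormedModule).
  subst x'. intros eps.
  generalize (filter_and _ _ HD (H eps (cond_pos eps))). apply filter_imp.
  intros y [Dy Hy]. specialize (Hy Dy).
  apply Rle_trans with (2 := Hy).
  apply Rle_trans with (2 := re_le_Cmod _).
  right. unfold minus, plus, opp, scal, norm; simpl. unfold abs, mult; simpl.
  f_equal. destruct (f y), (f x), l; simpl. ring.
Qed.

End DeriveOn.

(** * Mean value inequality and improper primitives *)

Lemma at_right_0_iff (P : R -> Prop) :
  at_right 0 P <-> exists d : R, (0 < d)%R /\ forall x, (0 < x < d)%R -> P x.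
Proof.
  split.
  - intros [d Hd]. exists d. split; [apply cond_pos |].
    intros x Hx. apply Hd; [| lra].
    change (Rabs (x - 0) < d)%R. rewrite Rminus_0_r, Rabs_right; lra.
  - intros [d [Hd H]]. exists (mkposreal d Hd). intros x Hx Px. apply H.
    change (Rabs (x - 0) < d)%R in Hx. rewrite Rminus_0_r, Rabs_right in Hx; lra.
Qed.

Lemma filterlim_0_dominated (F : R -> C) (G : R -> R) :
  at_right 0 (fun x => (Cmod (F x) <= G x)%R) ->
  filterlim G (at_right 0) (locally 0%R) ->
  filterlim F (at_right 0) (locally (T := C_UniformSpace) (RtoC 0)).
Proof.
  intros H HG. rewrite filterlim_C_iff by typeclasses eauto. intros eps He.
  generalize (filter_and _ _ H (proj1 (filterlim_locally G 0%R) HG (mkposreal _ He))).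
  apply filter_imp. intros x [H1 H2].
  change (Rabs (G x - 0) < eps)%R in H2. rewrite Rminus_0_r in H2.
  replace (F x - 0) with (F x) by ring.
  generalize (Rle_abs (G x)). lra.
Qed.

(** Freezing the argument at b turns continuity relative to (0,a] into two-sided continuity at every
    t > 0, endpoint included, as the real mean value theorem and [RInt] require. *)
Lemma cont_on_Rmin (a b : R) (F : R -> C) (t : R) :
  (0 < b <= a)%R -> cont_on (Ioc a) F -> (0 < t)%R ->
  continuous (U := C_UniformSpace) (fun s => F (Rmin b s)) t.
Proof.
  intros Hb HF Ht.
  assert (D : Ioc a (Rmin b t)).
  { split; [apply Rmin_glb_lt; lra |]. apply Rle_trans with (1 := Rmin_l _ _); lra. }
  apply (filterlim_comp _ _ _ (fun s => Rmin b s) F (locally t)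
    (within (Ioc a) (locally (Rmin b t)))); [| now apply HF].
  intros P [d Hd].
  assert (Hm : (0 < Rmin d t)%R) by (apply Rmin_glb_lt; [apply cond_pos | lra]).
  exists (mkposreal _ Hm). intros s Hs.
  change (Rabs (s - t) < Rmin d t)%R in Hs.
  assert (H1 : (Rabs (s - t) < d)%R) by (apply Rlt_le_trans with (1 := Hs), Rmin_l).
  assert (H2 : (Rabs (s - t) < t)%R) by (apply Rlt_le_trans with (1 := Hs), Rmin_r).
  apply Rabs_def2 in H2.
  apply Hd.
  - change (Rabs (Rmin b s - Rmin b t) < d)%R.
    apply Rle_lt_trans with (2 := H1).
    unfold Rmin. destruct (Rle_dec b s), (Rle_dec b t); unfold Rabs; repeat destruct Rcase_abs; lra.
  - split; [apply Rmin_glb_lt; lra |]. apply Rle_trans with (1 := Rmin_l _ _); lra.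
Qed.

(* The real mean value theorem for [Re (Cconj w * F) - Cmod w * G], where
   [w = F x - F y]. *)
Lemma mean_value_inequality (a b : R) (F dF : R -> C) (G dG : R -> R) (x y : R) :
  (forall t, Ioc a t -> is_derive_on (Ioc a) F t (dF t)) ->
  (forall t, (0 < t)%R -> is_derive G t (dG t)) ->
  (b <= a)%R ->
  (forall t, (0 < t <= b)%R -> (Cmod (dF t) <= dG t)%R) ->
  (0 < y <= x)%R -> (x <= b)%R ->
  (Cmod (F x - F y) <= G x - G y)%R.
Proof.
  intros HF HG Hb Hle Hy Hx.
  (* When F x = F y, the choice w = 1 keeps [Cmod w] positive for the final division. *)
  assert (exists w : C, w <> RtoC 0 /\ Cconj w * (F x - F y) = RtoC (Cmod w * Cmod (F x - F y))).
  { destruct (Ceq_dec (F x - F y) 0) as [E | N].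
    - exists (RtoC 1). split; [apply C1_nz |]. rewrite E, Cmod_0, Rmult_0_r. ring.
    - exists (F x - F y). split; auto.
      rewrite Cmult_comm, <- Cmod2_conj. f_equal. ring. }
  destruct H as [w [Nw Ew]].
  assert (Pw : (0 < Cmod w)%R) by now apply Cmod_gt_0.
  (* F is frozen beyond x so that phi is continuous at the endpoint x even when x = a. *)
  set (phi := fun t => (Re (Cconj w * F (Rmin x t)) - Cmod w * G t)%R).
  set (dphi := fun t => (Re (Cconj w * dF t) - Cmod w * dG t)%R).
  assert (HwF : forall t, Ioc a t ->
    is_derive_on (Ioc a) (fun s => Cconj w * F s) t (Cconj w * dF t)).
  { intros t Ht. apply is_derive_on_scal; auto. }
  destruct (MVT_gen phi y x dphi) as [c [Hc Ec]].
  - rewrite Rmin_left, Rmax_right by lra. intros t Ht.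
    apply is_derive_ext_loc with (fun s => (Re (Cconj w * F s) - Cmod w * G s)%R).
    + assert (Hd : (0 < x - t)%R) by lra. exists (mkposreal _ Hd).
      intros s Hs. change (Rabs (s - t) < x - t)%R in Hs. apply Rabs_def2 in Hs.
      unfold phi. rewrite Rmin_right by lra. reflexivity.
    + apply (is_derive_minus (fun s => Re (Cconj w * F s)) (fun s => (Cmod w * G s)%R)).
      * apply (is_derive_on_Re (Ioc a)); [| apply HwF; split; lra].
        assert (Hd : (0 < Rmin t (x - t))%R) by (apply Rmin_glb_lt; lra).
        exists (mkposreal _ Hd).
        intros s Hs. change (Rabs (s - t) < Rmin t (x - t))%R in Hs.
        assert (H1 := Rlt_le_trans _ _ _ Hs (Rmin_l _ _)).
        assert (H2 := Rlt_le_trans _ _ _ Hs (Rmin_r _ _)).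
        apply Rabs_def2 in H1. apply Rabs_def2 in H2. split; lra.
      * apply is_derive_scal. apply HG. lra.
  - rewrite Rmin_left, Rmax_right by lra. intros t Ht.
    apply continuity_pt_filterlim.
    apply (continuous_minus (fun t => Re (Cconj w * F (Rmin x t))) (fun t => (Cmod w * G t)%R)).
    + apply (continuous_comp (V := C_UniformSpace) (fun t => Cconj w * F (Rmin x t)) Re).
      * apply (cont_on_Rmin a x (fun s => Cconj w * F s)); try lra.
        apply is_derive_on_cont_on with (fun s => Cconj w * dF s). exact HwF.
      * apply continuous_fst.
    + apply (ex_derive_continuous (fun t => (Cmod w * G t)%R)).
      exists (Cmod w * dG t)%R. apply is_derive_scal, HG. lra.
  - rewrite Rmin_left, Rmax_right in Hc by lra.
    assert (Hn : (dphi c <= 0)%R).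
    { unfold dphi.
      assert (H1 := re_le_Cmod (Cconj w * dF c)).
      rewrite Cmod_mult, Cmod_conj in H1.
      assert (H2 := Rle_abs (Re (Cconj w * dF c))).
      assert (H3 : (Cmod w * Cmod (dF c) <= Cmod w * dG c)%R).
      { apply Rmult_le_compat_l; [lra |]. apply Hle. lra. }
      lra. }
    assert (Hp : (phi x - phi y <= 0)%R).
    { rewrite Ec. assert (0 <= x - y)%R by lra. nra. }
    unfold phi in Hp. rewrite Rmin_left, Rmin_right in Hp by lra.
    assert (Er : (Re (Cconj w * F x) - Re (Cconj w * F y) = Cmod w * Cmod (F x - F y))%R).
    { apply (f_equal Re) in Ew. simpl in Ew |- *. lra. }
    apply Rmult_le_reg_l with (Cmod w); lra.
Qed.

Section Primitives.
Variable a : R.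

(** The limit y -> 0 of the previous inequality. An improper integral is thus estimated from its
    derivative and its limit at 0 alone. *)
Lemma mean_value_inequality_0 (b : R) (F dF : R -> C) (G dG : R -> R) (l : C) (x : R) :
  (forall t, Ioc a t -> is_derive_on (Ioc a) F t (dF t)) ->
  (forall t, (0 < t)%R -> is_derive G t (dG t)) ->
  filterlim F (at_right 0) (locally (T := C_UniformSpace) l) ->
  filterlim G (at_right 0) (locally 0%R) ->
  (b <= a)%R ->
  (forall t, (0 < t <= b)%R -> (Cmod (dF t) <= dG t)%R) ->
  (0 < x <= b)%R ->
  (Cmod (F x - l) <= G x)%R.
Proof.
  intros HF HG LF LG Hb Hle Hx. apply le_epsilon. intros eps He.
  assert (He2 : (0 < eps / 2)%R) by lra.
  rewrite filterlim_C_iff in LF by typeclasses eauto.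
  generalize (filter_and _ _ (LF _ He2)
    (proj1 (filterlim_locally G 0%R) LG (mkposreal _ He2))).
  intros H. apply at_right_0_iff in H. destruct H as [d [Hd H]].
  set (y := (Rmin d x / 2)%R).
  assert (Hm : (0 < Rmin d x)%R) by (apply Rmin_glb_lt; lra).
  assert (Hyd := Rmin_l d x). assert (Hyx := Rmin_r d x).
  destruct (H y) as [H1 H2]; [unfold y; lra |].
  change (Rabs (G y - 0) < eps / 2)%R in H2. apply Rabs_def2 in H2.
  assert (M := mean_value_inequality a b F dF G dG x y HF HG Hb Hle).
  replace (F x - l) with ((F x - F y) + (F y - l)) by ring.
  apply Rle_trans with (1 := Cmod_triangle _ _).
  assert (Cmod (F x - F y) <= G x - G y)%R by (apply M; unfold y; lra). lra.
Qed.

Lemma derive_zero_eq (F dF : R -> C) (x y : R) :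
  (forall t, Ioc a t -> is_derive_on (Ioc a) F t 0) ->
  Ioc a x -> Ioc a y -> F x = F y.
Proof.
  intros H Hx Hy.
  assert (Q : forall x y, Ioc a x -> Ioc a y -> (y <= x)%R -> F x = F y).
  { clear x y Hx Hy. intros x y Hx Hy Hyx.
    assert (M := mean_value_inequality a a F (fun _ => 0) (fun _ => 0%R) (fun _ => 0%R) x y H).
    assert (E : (Cmod (F x - F y) <= 0 - 0)%R).
    { destruct Hx, Hy. apply M; try lra.
      - intros. apply @is_derive_const.
      - intros. rewrite Cmod_0. lra. }
    assert (Z : F x - F y = 0).
    { apply Cmod_eq_0. generalize (Cmod_ge_0 (F x - F y)). lra. }
    replace (F x) with (F x - F y + F y) by ring. rewrite Z. ring. }
  destruct (Rle_dec y x); [now apply Q |]. symmetry. apply Q; auto. lra.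
Qed.

Let J (F : R -> C) (x : R) : C :=
  RInt (V := C_R_CompleteNormedModule) (fun t => F (Rmin a t)) a x.

Let J_correct (F : R -> C) (x : R) :
  cont_on (Ioc a) F -> (0 < a)%R -> (0 < x)%R ->
  is_RInt (V := C_R_CompleteNormedModule) (fun t => F (Rmin a t)) a x (J F x).
Proof.
  intros HF Ha Hx. apply RInt_correct.
  apply (ex_RInt_continuous (V := C_R_CompleteNormedModule)).
  intros z Hz. apply (cont_on_Rmin a a F z); auto; [lra |].
  apply Rlt_le_trans with (2 := proj1 Hz). apply Rmin_glb_lt; lra.
Qed.

Let J_derive (F : R -> C) (x : R) :
  cont_on (Ioc a) F -> Ioc a x -> is_derive_on (Ioc a) (J F) x (F x).
Proof.
  intros HF Hx. apply is_derive_is_derive_on; auto.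
  replace (F x) with (F (Rmin a x)) by (rewrite Rmin_right; auto; apply Hx).
  apply (is_derive_RInt (V := C_R_NormedModule) (fun t => F (Rmin a t)) (J F) a x).
  - destruct Hx as [Hx1 Hx2]. exists (mkposreal _ Hx1). intros s Hs.
    change (Rabs (s - x) < x)%R in Hs. apply Rabs_def2 in Hs.
    apply J_correct; auto; lra.
  - destruct Hx. apply (cont_on_Rmin a a F x); auto; lra.
Qed.

(** Increments of [J F] are bounded by increments of G, which has a limit at 0. So [J F] is Cauchy
    at 0, and subtracting its limit yields the primitive. *)
Lemma primitive_exists (F : R -> C) (G dG : R -> R) :
  (0 < a)%R -> cont_on (Ioc a) F ->
  (forall t, (0 < t)%R -> is_derive G t (dG t)) ->
  filterlim G (at_right 0) (locally 0%R) ->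
  (forall t, Ioc a t -> (Cmod (F t) <= dG t)%R) ->
  exists Phi : R -> C,
    (forall x, Ioc a x -> is_derive_on (Ioc a) Phi x (F x)) /\
    filterlim Phi (at_right 0) (locally (T := C_UniformSpace) (RtoC 0)).
Proof.
  intros Ha HF HG LG Hle.
  destruct (proj1 (filterlim_locally_cauchy (U := C_R_CompleteNormedModule)
                     (F := at_right 0) (J F))) as [L HL].
  { intros eps.
    assert (He : (0 < eps / 2)%R) by (generalize (cond_pos eps); lra).
    assert (K := proj1 (filterlim_locally G 0%R) LG (mkposreal _ He)).
    apply at_right_0_iff in K. destruct K as [d [Hd K]].
    exists (fun x => 0 < x < Rmin d a)%R. split.
    { apply at_right_0_iff. exists (Rmin d a). split; auto. apply Rmin_glb_lt; auto. }
    assert (Q : forall u v, (0 < u < Rmin d a)%R -> (0 < v < Rmin d a)%R -> (v <= u)%R ->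
      (Cmod (J F u - J F v) < eps)%R).
    { intros u v Hu Hv Hvu.
      assert (D1 := Rmin_l d a). assert (D2 := Rmin_r d a).
      apply Rle_lt_trans with (G u - G v)%R.
      - apply (mean_value_inequality a a (J F) F G dG); try lra; [| exact HG | exact Hle].
        intros t Ht. now apply J_derive.
      - assert (K1 := K u). assert (K2 := K v).
        change (0 < u < d -> Rabs (G u - 0) < eps / 2)%R in K1.
        change (0 < v < d -> Rabs (G v - 0) < eps / 2)%R in K2.
        assert (K3 : (Rabs (G u - 0) < eps / 2)%R) by (apply K1; lra).
        assert (K4 : (Rabs (G v - 0) < eps / 2)%R) by (apply K2; lra).
        apply Rabs_def2 in K3. apply Rabs_def2 in K4. lra. }
    intros u v Hu Hv. apply C_NormedModule_mixin_compat1.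
    destruct (Rle_dec u v).
    - apply Q; auto.
    - change (Cmod (J F v - J F u) < eps)%R.
      rewrite <- Cmod_opp. replace (- (J F v - J F u)) with (J F u - J F v) by ring.
      apply Q; auto. lra. }
  exists (fun x => J F x - L). split.
  - intros x Hx. replace (F x) with (F x - 0) by ring.
    apply is_derive_on_minus; auto. now apply is_derive_on_const.
  - replace (RtoC 0) with (L + - L) by (apply Cplus_opp_r).
    apply filterlim_Cplus; [typeclasses eauto | exact HL | apply filterlim_const].
Qed.

(** [J F] - Phi has derivative 0, so the integral over [y,x] is Phi x - Phi y; then y -> 0.
    Linearity of [int0] on convergent integrands is later obtained from this. *)
Lemma int0_eq (F Phi : R -> C) (x : R) :
  cont_on (Ioc a) F ->
  (forall t, Ioc a t -> is_derive_on (Ioc a) Phi t (F t)) ->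
  filterlim Phi (at_right 0) (locally (T := C_UniformSpace) (RtoC 0)) ->
  Ioc a x -> int0 F x = Phi x.
Proof.
  intros HF HP LP Hx.
  assert (HI : forall y, (0 < y < x)%R ->
    is_RInt (V := C_R_CompleteNormedModule) F y x (Phi x - Phi y)).
  { intros y Hy. destruct Hx as [Hx1 Hx2].
    assert (E : J F x - Phi x = J F y - Phi y).
    { apply (derive_zero_eq (fun t => J F t - Phi t) (fun _ => 0)); try (split; lra).
      intros t Ht. replace (RtoC 0) with (F t - F t) by ring.
      apply is_derive_on_minus; auto. }
    replace (Phi x - Phi y) with (- J F y + J F x).
    2: { replace (J F x) with (J F x - Phi x + Phi x) by ring. rewrite E. ring. }
    apply (is_RInt_ext (V := C_R_CompleteNormedModule) (fun t => F (Rmin a t))).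
    { intros t. rewrite Rmin_left, Rmax_right by lra. intros Ht.
      rewrite Rmin_right by lra. reflexivity. }
    apply (is_RInt_Chasles (V := C_R_CompleteNormedModule) _ y a x).
    - apply (is_RInt_swap (V := C_R_CompleteNormedModule)). apply J_correct; auto; lra.
    - apply J_correct; auto; lra. }
  unfold int0.
  apply (is_RInt_gen_unique (V := C_R_CompleteNormedModule)
    (Fa := at_right 0) (Fb := at_point x) F).
  intros P HPx.
  assert (L : filterlim (fun y => Phi x - Phi y) (at_right 0)
               (locally (T := C_UniformSpace) (Phi x))).
  { replace (Phi x) with (Phi x + - 0) at 1 by ring.
    apply filterlim_Cplus; [typeclasses eauto | apply filterlim_const |].
    apply filterlim_Copp; [typeclasses eauto | exact LP]. }
  specialize (L P HPx).
  exists (fun y => P (Phi x - Phi y) /\ (0 < y < x)%R) (fun z => z = x).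
  - apply filter_and; [exact L |]. apply at_right_0_iff. exists x.
    destruct Hx. split; auto.
  - reflexivity.
  - intros y z [H1 H2] ->. exists (Phi x - Phi y). split; auto.
Qed.

Lemma int0_dominated (F : R -> C) (G dG : R -> R) :
  (0 < a)%R -> cont_on (Ioc a) F ->
  (forall t, (0 < t)%R -> is_derive G t (dG t)) ->
  filterlim G (at_right 0) (locally 0%R) ->
  (forall t, Ioc a t -> (Cmod (F t) <= dG t)%R) ->
  (forall x, Ioc a x -> is_derive_on (Ioc a) (int0 F) x (F x)) /\
  filterlim (int0 F) (at_right 0) (locally (T := C_UniformSpace) (RtoC 0)).
Proof.
  intros Ha HF HG LG Hle.
  destruct (primitive_exists F G dG Ha HF HG LG Hle) as [Phi [H1 H2]].
  assert (E : forall x, Ioc a x -> Phi x = int0 F x).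
  { intros x Hx. symmetry. now apply int0_eq. }
  split.
  - intros x Hx. apply is_derive_on_ext with Phi; auto.
  - apply filterlim_ext_loc with (2 := H2). apply at_right_0_iff.
    exists a. split; auto. intros x Hx. apply E. split; lra.
Qed.

End Primitives.

(** * Powers of x *)

Lemma Rpower_pos (x y : R) : (0 < Rpower x y)%R.
Proof. apply exp_pos. Qed.

Lemma is_derive_Rpower (x y : R) :
  (0 < x)%R -> is_derive (fun t => Rpower t y) x (y * Rpower x (y - 1))%R.
Proof. intros Hx. apply is_derive_Reals. now apply derivable_pt_lim_power. Qed.

Lemma filterlim_Rpower_0 (s : R) :
  (0 < s)%R -> filterlim (fun t => Rpower t s) (at_right 0) (locally 0%R).
Proof.
  intros Hs. apply (filterlim_locally (fun t => Rpower t s) 0%R). intros eps.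
  apply at_right_0_iff. exists (Rpower eps (/ s)). split; [apply Rpower_pos |].
  intros x Hx. change (Rabs (Rpower x s - 0) < eps)%R.
  rewrite Rminus_0_r, Rabs_right by (apply Rle_ge, Rlt_le, Rpower_pos).
  replace (pos eps) with (Rpower (Rpower eps (/ s)) s).
  - apply Rlt_Rpower_l; lra.
  - rewrite Rpower_mult, Rinv_l, Rpower_1 by (apply eps || lra). reflexivity.
Qed.

Lemma cont_on_Rpower (a y : R) : cont_on (Ioc a) (rpow y).
Proof.
  apply cont_on_RtoC. intros x [Hx _].
  apply (ex_derive_continuous (fun t => Rpower t y)).
  eexists. now apply is_derive_Rpower.
Qed.

Lemma filterlim_Rmult_0 (c : R) (G : R -> R) (F : (R -> Prop) -> Prop) :
  filterlim G F (locally 0%R) -> filterlim (fun x => c * G x)%R F (locally 0%R).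
Proof.
  intros H. replace 0%R with (c * 0)%R by ring.
  apply (filterlim_comp _ _ _ G (fun y => c * y)%R F (locally 0%R)).
  - exact H.
  - apply (continuous_scal_r c (fun y : R => y)), continuous_id.
Qed.

(* [h^n / n!] with [h t = t^s / s], the integral of the weight [t^(s-1)]. *)
Definition hpow (s : R) (n : nat) (t : R) : R :=
  ((Rpower t s / s) ^ n / INR (fact n))%R.

Section Hpow.
Variable s : R.
Hypothesis Hs : (0 < s)%R.

Lemma hpow_pos (n : nat) (t : R) : (0 < hpow s n t)%R.
Proof.
  apply Rdiv_lt_0_compat; [apply pow_lt | apply INR_fact_lt_0].
  apply Rdiv_lt_0_compat; auto. apply Rpower_pos.
Qed.

Lemma hpow_0 (t : R) : hpow s 0 t = 1%R.
Proof. unfold hpow. simpl. field. Qed.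

Lemma is_derive_hpow (n : nat) (t : R) :
  (0 < t)%R -> is_derive (hpow s (S n)) t (Rpower t (s - 1) * hpow s n t)%R.
Proof.
  intros Ht. unfold hpow.
  apply is_derive_ext with (fun t => / INR (fact (S n)) * (/ s * Rpower t s) ^ S n)%R.
  { intros x. rewrite (Rmult_comm (/ s)). apply Rmult_comm. }
  evar_last.
  - apply is_derive_scal. apply (is_derive_pow (fun t => / s * Rpower t s)%R).
    apply is_derive_scal.
    now apply is_derive_Rpower.
  - rewrite fact_simpl, mult_INR. simpl pred.
    unfold Rdiv. rewrite (Rmult_comm (Rpower t s)). field.
    repeat split; [apply INR_fact_neq_0 | lra | apply not_0_INR; discriminate].
Qed.

Lemma hpow_mono (n : nat) (x y : R) :
  (0 < x <= y)%R -> (hpow s n x <= hpow s n y)%R.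
Proof.
  intros H. unfold hpow. apply Rmult_le_compat_r.
  { left. apply Rinv_0_lt_compat, INR_fact_lt_0. }
  apply pow_incr. split.
  - left. apply Rdiv_lt_0_compat; auto. apply Rpower_pos.
  - apply Rmult_le_compat_r; [left; now apply Rinv_0_lt_compat |].
    apply Rle_Rpower_l; lra.
Qed.

(** Trades one power of h for a constant. In [dIop] the term with [Zop] carries a surplus factor h,
    which is absorbed into [hpow s 1 a] in this way. *)
Lemma hpow_S_le (n : nat) (x y : R) :
  (0 < x <= y)%R -> (hpow s (S n) x <= hpow s 1 y * hpow s n x)%R.
Proof.
  intros H.
  assert (E : (hpow s (S n) x = hpow s 1 x * hpow s n x / INR (S n))%R).
  { unfold hpow. rewrite fact_simpl, mult_INR. simpl (fact 1). rewrite INR_1. simpl pow.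
    field. repeat split; try lra; [apply INR_fact_neq_0 | apply not_0_INR; discriminate]. }
  rewrite E.
  assert (H1 := hpow_mono 1 x y H). assert (H2 := hpow_pos n x). assert (H3 := hpow_pos 1 x).
  apply Rle_trans with (hpow s 1 x * hpow s n x)%R.
  - apply Rle_div_l; [apply lt_0_INR; apply Nat.lt_0_succ |].
    rewrite <- (Rmult_1_r (hpow s 1 x * hpow s n x)) at 1.
    apply Rmult_le_compat_l; [nra |]. rewrite S_INR. generalize (pos_INR n). lra.
  - nra.
Qed.

Lemma filterlim_hpow_0 (n : nat) :
  filterlim (hpow s (S n)) (at_right 0) (locally 0%R).
Proof.
  assert (L : filterlim (fun t => hpow s n 1 / s * Rpower t s)%R (at_right 0) (locally 0%R)).
  { now apply filterlim_Rmult_0, filterlim_Rpower_0. }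
  apply (filterlim_le_le (F := at_right 0) (fun _ => 0%R) (hpow s (S n))
    (fun t => hpow s n 1 / s * Rpower t s)%R 0); [| apply filterlim_const | exact L].
  apply at_right_0_iff. exists 1%R. split; [lra |]. intros x Hx. split.
  - left. apply hpow_pos.
  - apply Rle_trans with (hpow s 1 x * hpow s n x)%R.
    + apply hpow_S_le. lra.
    + assert (hpow s n x <= hpow s n 1)%R by (apply hpow_mono; lra).
      assert (E : (hpow s 1 x = Rpower x s / s)%R).
      { unfold hpow. simpl. field. lra. }
      assert (H1 := hpow_pos 1 x). assert (H2 := hpow_pos n x).
      replace (hpow s n 1 / s * Rpower x s)%R with (hpow s 1 x * hpow s n 1)%R
        by (rewrite E; field; lra).
      nra.
Qed.

End Hpow.

(** * Dominated series *)

(** [Series] is total, so [CSeries] is meaningful only once convergence is known; the projections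
    are continuous and carry the limit over. *)
Lemma is_Cseries_CSeries (t : nat -> C) (l : C) : is_Cseries t l -> CSeries t = l.
Proof.
  intros H.
  assert (E : forall N, sum_n (G := C_R_NormedModule) t N
              = (sum_n (fun n => Re (t n)) N, sum_n (fun n => Im (t n)) N)).
  { induction N as [| N IH]; [rewrite !sum_O; apply surjective_pairing |].
    rewrite !sum_Sn, IH. reflexivity. }
  unfold CSeries. rewrite (surjective_pairing l). f_equal.
  - apply is_series_unique.
    apply filterlim_ext with (fun N => Re (sum_n (G := C_R_NormedModule) t N)).
    { intros N. now rewrite E. }
    apply (filterlim_comp _ _ _ _ Re _ _ _ H). apply continuous_fst.
  - apply is_series_unique.
    apply filterlim_ext with (fun N => Im (sum_n (G := C_R_NormedModule) t N)).
    { intros N. now rewrite E. }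
    apply (filterlim_comp _ _ _ _ Im _ _ _ H). apply continuous_snd.
Qed.

(** The Weierstrass test with its remainder. The explicit tail bound is what later gives convergence
    uniform in x. *)
Lemma Cseries_dominated (t : nat -> C) (b : nat -> R) (B : R) :
  (forall n, (Cmod (t n) <= b n)%R) -> is_series b B ->
  is_Cseries t (CSeries t) /\
  forall N, (Cmod (CSeries t - sum_n (G := C_R_NormedModule) t N) <= B - sum_n b N)%R.
Proof.
  intros Hb HB.
  destruct (ex_series_le (V := C_R_CompleteNormedModule) t b) as [l Hl].
  { intros n. generalize (Hb n). now rewrite Cmod_norm. }
  { now exists B. }
  rewrite (is_Cseries_CSeries t l) by exact Hl. split; [exact Hl |].
  intros N. apply le_epsilon. intros eps He.
  assert (He2 : (0 < eps / 2)%R) by lra.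
  (* Finite blocks of the series are compared first; the bound on the whole tail is their limit as m
     grows. *)
  assert (T : forall m, (Cmod (sum_n (G := C_R_NormedModule) t (N + m)
      - sum_n (G := C_R_NormedModule) t N) <= sum_n b (N + m) - sum_n b N)%R).
  { induction m as [| m IH].
    - rewrite Nat.add_0_r. unfold Cminus. rewrite Cplus_opp_r, Cmod_0. lra.
    - rewrite Nat.add_succ_r, !sum_Sn.
      replace (plus (sum_n (G := C_R_NormedModule) t (N + m)) (t (S (N + m)))
                - sum_n (G := C_R_NormedModule) t N)
        with ((sum_n (G := C_R_NormedModule) t (N + m)
                - sum_n (G := C_R_NormedModule) t N) + t (S (N + m))).
      2: { change (plus (sum_n (G := C_R_NormedModule) t (N + m)) (t (S (N + m))))
             with (Cplus (sum_n (G := C_R_NormedModule) t (N + m)) (t (S (N + m)))). ring. }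
      apply Rle_trans with (1 := Cmod_triangle _ _).
      change (plus (sum_n b (N + m)) (b (S (N + m)))) with (sum_n b (N + m) + b (S (N + m)))%R.
      generalize (Hb (S (N + m))). lra. }
  assert (Hl' := proj1 (filterlim_C_iff nat eventually _ l _) Hl _ He2).
  assert (HB' := proj1 (filterlim_locally (sum_n b) B) HB (mkposreal _ He2)).
  destruct (filter_and _ _ Hl' HB') as [M HM].
  destruct (HM (N + M)%nat) as [H1 H2]; [lia |].
  change (Rabs (sum_n b (N + M) - B) < eps / 2)%R in H2. apply Rabs_def2 in H2.
  replace (l - sum_n (G := C_R_NormedModule) t N) with
    (- (sum_n (G := C_R_NormedModule) t (N + M) - l)
     + (sum_n (G := C_R_NormedModule) t (N + M) - sum_n (G := C_R_NormedModule) t N)) by ring.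
  apply Rle_trans with (1 := Cmod_triangle _ _). rewrite Cmod_opp.
  change (Cmod (sum_n (G := C_R_NormedModule) t (N + M) - l) < eps / 2)%R in H1.
  generalize (T M). lra.
Qed.

Lemma cont_on_uniform_limit (D : R -> Prop) (U : nat -> R -> C) (u : R -> C) (tau : nat -> R) :
  (forall N, cont_on D (U N)) ->
  (forall N x, D x -> (Cmod (u x - U N x) <= tau N)%R) ->
  is_lim_seq tau 0 -> cont_on D u.
Proof.
  intros HU Hle Ht x Hx. rewrite filterlim_C_iff by typeclasses eauto. intros eps He.
  assert (He3 : (0 < eps / 3)%R) by lra.
  apply is_lim_seq_spec in Ht. destruct (Ht (mkposreal _ He3)) as [N HN].
  specialize (HN N (Nat.le_refl N)). simpl in HN. rewrite Rminus_0_r in HN.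
  apply Rabs_def2 in HN.
  assert (K := proj1 (filterlim_C_iff R _ (U N) _ _) (HU N x Hx) _ He3).
  revert K. unfold within. apply filter_imp. intros y Hy Dy. specialize (Hy Dy).
  replace (u y - u x) with ((u y - U N y) + ((U N y - U N x) + - (u x - U N x))) by ring.
  apply Rle_lt_trans with (1 := Cmod_triangle _ _).
  apply Rle_lt_trans with (1 := Rplus_le_compat_l _ _ _ (Cmod_triangle _ _)).
  rewrite Cmod_opp. generalize (Hle N x Hx) (Hle N y Dy). lra.
Qed.

(** * The Volterra operator of a perturbation *)

Lemma Cmod_plus_le (x y : C) (A B : R) :
  (Cmod x <= A -> Cmod y <= B -> Cmod (x + y) <= A + B)%R.
Proof. intros. apply Rle_trans with (1 := Cmod_triangle _ _). lra. Qed.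

Lemma Cmod_mult_le (x y : C) (A B : R) :
  (Cmod x <= A -> Cmod y <= B -> Cmod (x * y)%C <= A * B)%R.
Proof.
  intros. rewrite Cmod_mult.
  apply Rmult_le_compat; auto using Cmod_ge_0.
Qed.

Section Operator.
(** [sigma] stands for kappa/x in the first use and for kappa/x + q in the second. This singular
    coefficient enters the estimates only through the bounds on f, 1/f and g. One constant K >= 1
    serves for all bounds, so that its powers can be compared. *)
Variables (a s kappa K : R) (sigma p1 p2 r11 r12 r21 r22 f g : R -> C).
Let w (t : R) : R := Rpower t (s - 1).
Let P (t : R) : R := Rpower t kappa.
Let D : R -> Prop := Ioc a.

Hypothesis Ha : (0 < a)%R.
Hypothesis Hs : (0 < s)%R.
Hypothesis Hkappa : (0 <= kappa)%R.
Hypothesis HK : (1 <= K)%R.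
Hypothesis Cp2 : cont_on D p2.
Hypothesis Cr11 : cont_on D r11.
Hypothesis Cr12 : cont_on D r12.
Hypothesis Cr21 : cont_on D r21.
Hypothesis Cr22 : cont_on D r22.
Hypothesis Df : forall x, D x -> is_derive_on D f x (sigma x * f x + p2 x * g x).
Hypothesis Dg : forall x, D x -> is_derive_on D g x (- (p1 x * f x) - sigma x * g x).
Hypothesis f_neq_0 : forall x, D x -> f x <> 0.
Hypothesis Bf : forall x, D x -> (Cmod (f x) <= K * P x)%R.
Hypothesis Bif : forall x, D x -> (Cmod (/ f x) <= K / P x)%R.
Hypothesis Bg : forall x, D x -> (Cmod (g x) <= K * P x)%R.
Hypothesis Bp2 : forall x, D x -> (Cmod (p2 x) <= K * w x)%R.
Hypothesis Br11 : forall x, D x -> (Cmod (r11 x) <= K * w x)%R.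
Hypothesis Br12 : forall x, D x -> (Cmod (r12 x) <= K * w x)%R.
Hypothesis Br21 : forall x, D x -> (Cmod (r21 x) <= K * w x)%R.
Hypothesis Br22 : forall x, D x -> (Cmod (r22 x) <= K * w x)%R.

(* [(TX, TY)] is one step of the recursion [XY] without its factor [n + 1], so
   that [XY n = n! T^n (f, g)]. *)
Definition dZop (X Y : R -> C) (t : R) : C :=
  X t * (f t * r11 t + g t * r21 t) + Y t * (f t * r12 t + g t * r22 t).
(** This is the Wronskian f * TY - g * TX. Differentiating it by the homogeneous system for (f, g)
    and the inhomogeneous one for (TX, TY), all terms with sigma, p1 and p2 cancel and [dZop]
    remains. *)
Definition Zop (X Y : R -> C) : R -> C := int0 (dZop X Y).
(** The derivative of TX / f: the quotient rule removes sigma, and TY has been eliminated through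
    the Wronskian, which leaves p2 * Zop / f^2. *)
Definition dIop (X Y : R -> C) (t : R) : C :=
  - (r21 t / f t) * X t - r22 t / f t * Y t + p2 t / (f t * f t) * Zop X Y t.
Definition Iop (X Y : R -> C) : R -> C := int0 (dIop X Y).
Definition TX (X Y : R -> C) (x : R) : C := f x * Iop X Y x.
Definition TY (X Y : R -> C) (x : R) : C :=
  1 / f x * Zop X Y x + g x / f x * TX X Y x.

Let H : R := hpow s 1 a.
(** 2 K^2 comes from the terms with r21 / f and r22 / f; 4 K^5 H from p2 / f^2, of size K^3, times
    the factor 4 K^2 of [Zop] and the surplus factor h <= H. *)
Let B1 : R := (2 * K ^ 2 + 4 * K ^ 5 * H)%R.
(** The two summands of [TY]: [Zop] / f contributes K times 4 K^2, and (g / f) * [TX] contributes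
    K^2 times K B1. This also dominates [TX], of size K B1. *)
Definition Top_bound : R := (4 * K ^ 3 + K ^ 3 * B1)%R.

Let Pw (t : R) : (0 < P t)%R.
Proof. apply Rpower_pos. Qed.
Let ww (t : R) : (0 < w t)%R.
Proof. apply Rpower_pos. Qed.
Let PP (t x : R) : (0 < t <= x -> P t <= P x)%R.
Proof. intros. apply Rle_Rpower_l; auto. Qed.
Let HH : (0 < H)%R.
Proof. now apply hpow_pos. Qed.
Let Cf : cont_on D f.
Proof. eapply is_derive_on_cont_on, Df. Qed.
Let Cg : cont_on D g.
Proof. eapply is_derive_on_cont_on, Dg. Qed.

Lemma pos_Top_bound : (0 < Top_bound)%R.
Proof.
  unfold Top_bound, B1.
  assert (0 < K ^ 2)%R by (apply pow_lt; lra). assert (0 < K ^ 3)%R by (apply pow_lt; lra).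
  assert (0 < K ^ 5 * H)%R by (apply Rmult_lt_0_compat; auto; apply pow_lt; lra). nra.
Qed.

(* Each application of [T] raises the exponent of [h] and adds a factor
   [1 / n], so the series of the [T^n (f, g)] is dominated by an exponential. *)
Definition weighted (M : R) (n : nat) (X Y : R -> C) : Prop :=
  cont_on D X /\ cont_on D Y /\
  forall x, D x -> (Cmod (X x) <= M * (P x * hpow s n x))%R /\
                   (Cmod (Y x) <= M * (P x * hpow s n x))%R.

(** * Estimates and derivatives for one application of the Volterra operator *)

Section Bounds.
Variables (M : R) (n : nat) (X Y : R -> C).
Hypothesis HM : (0 <= M)%R.
Hypothesis HXY : weighted M n X Y.

Lemma cont_on_dZop : cont_on D (dZop X Y).
Proof.
  destruct HXY as [CX [CY _]].
  apply cont_on_plus; apply cont_on_mult; auto; apply cont_on_plus; now apply cont_on_mult.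
Qed.

(** Freezing x^(2 kappa) at the right end makes the majorant a constant times the derivative of
    [hpow s (S n)]. Keeping it as P x ^ 2, and not as P a ^ 2, is essential: it cancels against 1 /
    f^2 in [dIop]. *)
Let bound_dZop (x t : R) :
  D t -> (t <= x)%R ->
  (Cmod (dZop X Y t) <= (4 * K ^ 2 * M * P x ^ 2) * (w t * hpow s n t))%R.
Proof.
  intros Ht Hx.
  apply Rle_trans with (4 * K ^ 2 * M * P t ^ 2 * (w t * hpow s n t))%R.
  - replace (4 * K ^ 2 * M * P t ^ 2 * (w t * hpow s n t))%R with
      (M * (P t * hpow s n t) * (K * P t * (K * w t) + K * P t * (K * w t))
       + M * (P t * hpow s n t) * (K * P t * (K * w t) + K * P t * (K * w t)))%R by ring.
    destruct HXY as [_ [_ BXY]]. destruct (BXY t Ht).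
    apply Cmod_plus_le; apply Cmod_mult_le; auto; apply Cmod_plus_le; apply Cmod_mult_le; auto.
  - assert (H1 := hpow_pos s Hs n t). assert (H2 := ww t). assert (H3 := Pw t).
    apply Rmult_le_compat_r; [nra |]. apply Rmult_le_compat_l.
    { repeat apply Rmult_le_pos; try lra; simpl; nra. }
    apply pow_incr. split; [lra |]. apply PP. destruct Ht; lra.
Qed.

Let is_derive_majorant (c : R) (m : nat) (t : R) :
  (0 < t)%R -> is_derive (fun x => c * hpow s (S m) x)%R t (c * (w t * hpow s m t))%R.
Proof. intros Ht. apply is_derive_scal. now apply is_derive_hpow. Qed.

Let majorant_0 (c : R) (m : nat) :
  filterlim (fun x => c * hpow s (S m) x)%R (at_right 0) (locally 0%R).
Proof. now apply filterlim_Rmult_0, filterlim_hpow_0. Qed.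

Lemma Zop_primitive :
  (forall x, D x -> is_derive_on D (Zop X Y) x (dZop X Y x)) /\
  filterlim (Zop X Y) (at_right 0) (locally (T := C_UniformSpace) (RtoC 0)).
Proof.
  apply (int0_dominated a _ _ _ Ha cont_on_dZop
    (is_derive_majorant (4 * K ^ 2 * M * P a ^ 2) n) (majorant_0 _ n)).
  intros t Ht. apply bound_dZop; auto. apply Ht.
Qed.

Lemma Zop_bound (x : R) :
  D x -> (Cmod (Zop X Y x) <= 4 * K ^ 2 * M * P x ^ 2 * hpow s (S n) x)%R.
Proof.
  intros Hx. destruct Zop_primitive as [Z1 Z2].
  replace (Zop X Y x) with (Zop X Y x - 0) by ring.
  apply (mean_value_inequality_0 a x _ _ _ _ 0 x Z1
    (is_derive_majorant (4 * K ^ 2 * M * P x ^ 2) n) Z2 (majorant_0 _ n)).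
  - apply Hx.
  - intros t Ht. apply bound_dZop; [| apply Ht]. destruct Hx; split; lra.
  - destruct Hx; lra.
Qed.

Lemma cont_on_dIop : cont_on D (dIop X Y).
Proof.
  destruct HXY as [CX [CY _]].
  assert (Cz : cont_on D (Zop X Y)) by apply (is_derive_on_cont_on _ _ _ (proj1 Zop_primitive)).
  apply cont_on_plus; [apply cont_on_minus |]; apply cont_on_mult; auto.
  - apply cont_on_opp. now apply cont_on_div.
  - now apply cont_on_div.
  - apply cont_on_div; auto; [| now apply cont_on_mult].
    intros x Hx. now apply Cmult_neq_0; apply f_neq_0.
Qed.

Let bound_dIop (t : R) :
  D t -> (Cmod (dIop X Y t) <= M * B1 * (w t * hpow s n t))%R.
Proof.
  intros Ht. destruct HXY as [_ [_ BXY]]. destruct (BXY t Ht) as [BX BY].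
  assert (H1 := hpow_pos s Hs n t). assert (H2 := ww t). assert (H3 := Pw t).
  assert (HS := hpow_S_le s Hs n t a Ht). fold H in HS.
  apply Rle_trans with (K * w t * (K / P t) * (M * (P t * hpow s n t))
    + K * w t * (K / P t) * (M * (P t * hpow s n t))
    + K * w t * (K / P t * (K / P t)) * (4 * K ^ 2 * M * P t ^ 2 * hpow s (S n) t))%R.
  - unfold dIop, Cdiv, Cminus. apply Cmod_plus_le; [apply Cmod_plus_le |].
    + apply Cmod_mult_le; auto. rewrite Cmod_opp. apply Cmod_mult_le; auto.
    + rewrite Cmod_opp. apply Cmod_mult_le; auto. apply Cmod_mult_le; auto.
    + apply Cmod_mult_le; [| now apply Zop_bound].
      apply Cmod_mult_le; auto. replace (/ (f t * f t)) with (/ f t * / f t) by (field; auto).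
      apply Cmod_mult_le; auto.
  - replace (K * w t * (K / P t) * (M * (P t * hpow s n t)))%R
      with (K ^ 2 * M * (w t * hpow s n t))%R by (field; lra).
    replace (K * w t * (K / P t * (K / P t)) * (4 * K ^ 2 * M * P t ^ 2 * hpow s (S n) t))%R
      with (4 * K ^ 5 * M * w t * hpow s (S n) t)%R by (field; lra).
    assert (4 * K ^ 5 * M * w t * hpow s (S n) t <= 4 * K ^ 5 * M * w t * (H * hpow s n t))%R.
    { apply Rmult_le_compat_l; auto.
      repeat apply Rmult_le_pos; try lra.  }
    unfold B1. lra.
Qed.

Lemma Iop_primitive :
  (forall x, D x -> is_derive_on D (Iop X Y) x (dIop X Y x)) /\
  filterlim (Iop X Y) (at_right 0) (locally (T := C_UniformSpace) (RtoC 0)).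
Proof.
  apply (int0_dominated a _ _ _ Ha cont_on_dIop
    (is_derive_majorant (M * B1) n) (majorant_0 _ n) bound_dIop).
Qed.

Lemma Iop_bound (x : R) :
  D x -> (Cmod (Iop X Y x) <= M * B1 * hpow s (S n) x)%R.
Proof.
  intros Hx. destruct Iop_primitive as [Z1 Z2].
  replace (Iop X Y x) with (Iop X Y x - 0) by ring.
  apply (mean_value_inequality_0 a x _ _ _ _ 0 x Z1
    (is_derive_majorant (M * B1) n) Z2 (majorant_0 _ n)).
  - apply Hx.
  - intros t Ht. apply bound_dIop. destruct Hx; split; lra.
  - destruct Hx; lra.
Qed.

(** The derivative of f produces sigma, and what remains, p2 * (g * [Iop] + [Zop] / f), is p2 *
    [TY]. *)
Lemma TX_derive (x : R) :
  D x ->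
  is_derive_on D (TX X Y) x
    (sigma x * TX X Y x + p2 x * TY X Y x - (r21 x * X x + r22 x * Y x)).
Proof.
  intros Hx.
  replace (sigma x * TX X Y x + p2 x * TY X Y x - (r21 x * X x + r22 x * Y x))
    with ((sigma x * f x + p2 x * g x) * Iop X Y x + f x * dIop X Y x).
  - apply is_derive_on_mult; auto. now apply Iop_primitive.
  - unfold TY, TX, dIop. field. auto.
Qed.

Lemma TY_derive (x : R) :
  D x ->
  is_derive_on D (TY X Y) x
    (- (p1 x * TX X Y x) - sigma x * TY X Y x + (r11 x * X x + r12 x * Y x)).
Proof.
  intros Hx.
  assert (Dif := is_derive_on_inv D f x _ f_neq_0 Hx (Df x Hx)).
  (* Factoring out 1 / f lets the derivative of [TX] be reused. *)
  assert (E : is_derive_on D (fun y => / f y * (Zop X Y y + g y * TX X Y y)) x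
    (- (sigma x * f x + p2 x * g x) / (f x * f x) * (Zop X Y x + g x * TX X Y x)
     + / f x * (dZop X Y x + ((- (p1 x * f x) - sigma x * g x) * TX X Y x
        + g x * (sigma x * TX X Y x + p2 x * TY X Y x - (r21 x * X x + r22 x * Y x)))))).
  { apply is_derive_on_mult; auto. apply is_derive_on_plus; auto.
    - now apply Zop_primitive.
    - apply is_derive_on_mult; auto. now apply TX_derive. }
  apply is_derive_on_ext with (2 := Hx) (g := TY X Y) in E.
  - replace (- (p1 x * TX X Y x) - sigma x * TY X Y x + (r11 x * X x + r12 x * Y x))
      with (- (sigma x * f x + p2 x * g x) / (f x * f x) * (Zop X Y x + g x * TX X Y x)
     + / f x * (dZop X Y x + ((- (p1 x * f x) - sigma x * g x) * TX X Y x
        + g x * (sigma x * TX X Y x + p2 x * TY X Y x - (r21 x * X x + r22 x * Y x)))));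
      auto.
    unfold TY, TX, dZop. field. auto.
  - intros y Hy. unfold TY. field. auto.
Qed.

Lemma weighted_T : weighted (Top_bound * M) (S n) (TX X Y) (TY X Y).
Proof.
  split; [| split].
  - eapply is_derive_on_cont_on, TX_derive.
  - eapply is_derive_on_cont_on, TY_derive.
  - intros x Hx.
    assert (H1 := hpow_pos s Hs (S n) x). assert (H3 := Pw x).
    assert (HB1 : (0 <= B1)%R).
    { unfold B1. assert (0 <= K ^ 2)%R by (apply pow_le; lra).
      assert (0 <= K ^ 5 * H)%R by (apply Rmult_le_pos; [apply pow_le |]; lra). lra. }
    assert (BX : (Cmod (TX X Y x) <= K * P x * (M * B1 * hpow s (S n) x))%R).
    { apply Cmod_mult_le; auto. now apply Iop_bound. }
    assert (Q : (0 <= M * (P x * hpow s (S n) x))%R) by (apply Rmult_le_pos; nra).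
    split.
    + apply Rle_trans with (1 := BX). unfold Top_bound.
      replace (K * P x * (M * B1 * hpow s (S n) x))%R
        with (K * B1 * (M * (P x * hpow s (S n) x)))%R by ring.
      rewrite (Rmult_assoc _ M). apply Rmult_le_compat_r; auto.
      assert (K * B1 <= K ^ 3 * B1)%R by (apply Rmult_le_compat_r; simpl; nra).
      assert (0 <= K ^ 3)%R by (apply pow_le; lra). lra.
    + apply Rle_trans with (1 * (K / P x) * (4 * K ^ 2 * M * P x ^ 2 * hpow s (S n) x)
        + K * P x * (K / P x) * (K * P x * (M * B1 * hpow s (S n) x)))%R.
      * unfold TY, Cdiv. apply Cmod_plus_le; apply Cmod_mult_le; auto.
        -- apply Cmod_mult_le; auto. rewrite Cmod_1. lra.
        -- now apply Zop_bound.
        -- apply Cmod_mult_le; auto.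
      * right. unfold Top_bound. field. lra.
Qed.

End Bounds.

(** * Linearity of the Volterra operator on functions of order x^kappa *)

Section Linear.
Variables (M M' : R) (X Y X' Y' : R -> C) (c : C).
Hypothesis HM : (0 <= M)%R.
Hypothesis HM' : (0 <= M')%R.
Hypothesis HXY : weighted M 0 X Y.
Hypothesis HXY' : weighted M' 0 X' Y'.

Lemma weighted_lincomb :
  weighted (M + Cmod c * M') 0 (fun t => X t + c * X' t) (fun t => Y t + c * Y' t).
Proof.
  destruct HXY as [CX [CY B]], HXY' as [CX' [CY' B']].
  assert (Cc := cont_on_const D c).
  split; [| split]; try (apply cont_on_plus; auto; now apply cont_on_mult).
  intros x Hx. destruct (B x Hx), (B' x Hx).
  rewrite Rmult_plus_distr_r, (Rmult_assoc (Cmod c)).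
  split; apply Cmod_plus_le; auto; apply Cmod_mult_le; auto; apply Rle_refl.
Qed.

Let HN : (0 <= M + Cmod c * M')%R.
Proof. generalize (Rmult_le_pos _ _ (Cmod_ge_0 c) HM'). lra. Qed.

Let lincomb_0 (F G : R -> C) :
  filterlim F (at_right 0) (locally (T := C_UniformSpace) (RtoC 0)) ->
  filterlim G (at_right 0) (locally (T := C_UniformSpace) (RtoC 0)) ->
  filterlim (fun t => F t + c * G t) (at_right 0) (locally (T := C_UniformSpace) (RtoC 0)).
Proof.
  intros HF HG. replace (RtoC 0) with (0 + c * 0) by ring.
  apply filterlim_Cplus; [typeclasses eauto | exact HF |].
  apply filterlim_Cmult; [typeclasses eauto | apply filterlim_const | exact HG].
Qed.

(** An improper integral is additive only where both parts converge. The weighted bounds provide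
    this: the combination of the two primitives vanishes at 0 and is therefore the integral of the
    combination. *)
Lemma Zop_lincomb (x : R) :
  D x ->
  Zop (fun t => X t + c * X' t) (fun t => Y t + c * Y' t) x
  = Zop X Y x + c * Zop X' Y' x.
Proof.
  intros Hx.
  destruct (Zop_primitive M 0 X Y HM HXY) as [Z1 Z2].
  destruct (Zop_primitive M' 0 X' Y' HM' HXY') as [Z1' Z2'].
  apply (int0_eq a (dZop (fun t => X t + c * X' t) (fun t => Y t + c * Y' t))
    (fun t => Zop X Y t + c * Zop X' Y' t) x); [| | now apply lincomb_0 | exact Hx].
  - exact (cont_on_dZop _ _ _ _ weighted_lincomb).
  - intros t Ht.
    replace (dZop _ _ t) with (dZop X Y t + c * dZop X' Y' t) by (unfold dZop; ring).
    apply is_derive_on_plus; [assumption | now apply Z1 |].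
    apply is_derive_on_scal; [assumption | now apply Z1'].
Qed.

Lemma Iop_lincomb (x : R) :
  D x ->
  Iop (fun t => X t + c * X' t) (fun t => Y t + c * Y' t) x
  = Iop X Y x + c * Iop X' Y' x.
Proof.
  intros Hx.
  destruct (Iop_primitive M 0 X Y HM HXY) as [Z1 Z2].
  destruct (Iop_primitive M' 0 X' Y' HM' HXY') as [Z1' Z2'].
  apply (int0_eq a (dIop (fun t => X t + c * X' t) (fun t => Y t + c * Y' t))
    (fun t => Iop X Y t + c * Iop X' Y' t) x); [| | now apply lincomb_0 | exact Hx].
  - exact (cont_on_dIop _ _ _ _ HN weighted_lincomb).
  - intros t Ht.
    replace (dIop _ _ t) with (dIop X Y t + c * dIop X' Y' t).
    2: { unfold dIop. rewrite Zop_lincomb by exact Ht. unfold Cdiv. ring. }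
    apply is_derive_on_plus; [assumption | now apply Z1 |].
    apply is_derive_on_scal; [assumption | now apply Z1'].
Qed.

Lemma T_lincomb (x : R) :
  D x ->
  TX (fun t => X t + c * X' t) (fun t => Y t + c * Y' t) x = TX X Y x + c * TX X' Y' x /\
  TY (fun t => X t + c * X' t) (fun t => Y t + c * Y' t) x = TY X Y x + c * TY X' Y' x.
Proof.
  intros Hx. unfold TY, TX. rewrite (Iop_lincomb x Hx), (Zop_lincomb x Hx).
  unfold Cdiv. split; ring.
Qed.

End Linear.

(** * The Neumann series, its convergence and its fixed-point equation *)

Section Series.
Variable lambda : C.

Let X (n : nat) : R -> C := Xpow f g p2 r11 r12 r21 r22 n.
Let Y (n : nat) : R -> C := Ypow f g p2 r11 r12 r21 r22 n.
Let coef (n : nat) : C := Cpow lambda n / RtoC (INR (fact n)).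

Lemma Xpow_S (n : nat) (x : R) : X (S n) x = RtoC (INR (S n)) * TX (X n) (Y n) x.
Proof.
  unfold X, Y, Xpow, Ypow. cbn [XY]. destruct (XY f g p2 r11 r12 r21 r22 n) as [U V].
  symmetry. apply Cmult_assoc.
Qed.

Lemma Ypow_S (n : nat) (x : R) : Y (S n) x = RtoC (INR (S n)) * TY (X n) (Y n) x.
Proof.
  unfold TY.
  transitivity (RtoC (INR (S n)) * (1 / f x) * Zop (X n) (Y n) x + g x / f x * X (S n) x).
  - unfold X, Y, Xpow, Ypow. cbn [XY]. destruct (XY f g p2 r11 r12 r21 r22 n) as [U V].
    reflexivity.
  - rewrite Xpow_S. ring.
Qed.

Lemma weighted_ext (M : R) (n : nat) (U V U' V' : R -> C) :
  (forall x, D x -> U x = U' x /\ V x = V' x) ->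
  weighted M n U V -> weighted M n U' V'.
Proof.
  intros E [CU [CV B]]. split; [| split].
  - apply cont_on_ext with U; auto. intros x Hx. now apply E.
  - apply cont_on_ext with V; auto. intros x Hx. now apply E.
  - intros x Hx. destruct (E x Hx) as [<- <-]. auto.
Qed.

Lemma weighted_scal (c : C) (M : R) (n : nat) (U V : R -> C) :
  weighted M n U V -> weighted (Cmod c * M) n (fun x => c * U x) (fun x => c * V x).
Proof.
  intros [CU [CV B]]. split; [| split]; try (apply cont_on_mult; auto; apply cont_on_const).
  intros x Hx. destruct (B x Hx). rewrite Rmult_assoc.
  split; apply Cmod_mult_le; auto; apply Rle_refl.
Qed.

(** The factorial in this bound cancels against the coefficient lambda^n / n!; convergence of the
    series rests on the other factorial, inside [hpow]. *)
Lemma weighted_XY (n : nat) :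
  weighted (K * (Top_bound ^ n * INR (fact n))) n (X n) (Y n).
Proof.
  assert (HT := pos_Top_bound).
  induction n as [| n IH].
  - split; [exact Cf | split; [exact Cg |]]. intros x Hx.
    rewrite hpow_0. simpl. rewrite !Rmult_1_r. split; [now apply Bf | now apply Bg].
  - apply weighted_T in IH.
    2: { apply Rmult_le_pos; [lra |]. apply Rmult_le_pos; [apply pow_le; lra | apply pos_INR]. }
    apply (weighted_scal (RtoC (INR (S n)))) in IH.
    rewrite Cmod_R, Rabs_right in IH by (apply Rle_ge, pos_INR).
    replace (INR (S n) * (Top_bound * (K * (Top_bound ^ n * INR (fact n)))))%R
      with (K * (Top_bound ^ S n * INR (fact (S n))))%R in IH.
    2: { rewrite fact_simpl, mult_INR. simpl pow. ring. }
    revert IH. apply weighted_ext. intros x _. now rewrite Xpow_S, Ypow_S.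
Qed.

(** [e] lists the terms of the exponential series at [base], and [tau N] is K times its tail: the
    N-th remainder relative to x^kappa, uniformly on (0,a]. *)
Let base : R := (Cmod lambda * Top_bound * (Rpower a s / s))%R.
Let e (n : nat) : R := (/ INR (fact n) * base ^ n)%R.
Let tau (N : nat) : R := (K * (exp base - sum_n e N))%R.
Let u (x : R) : C := CSeries (fun n => coef n * X n x).
Let v (x : R) : C := CSeries (fun n => coef n * Y n x).

Let is_series_e : is_series e (exp base).
Proof.
  apply (is_series_ext (fun n => scal (pow_n base n) (/ INR (fact n))%R)).
  - intros n. rewrite pow_n_pow. apply Rmult_comm.
  - apply is_exp_Reals.
Qed.

Let tau_0 : is_lim_seq tau 0.
Proof.
  replace 0%R with (K * (exp base - exp base))%R by ring.
  apply (is_lim_seq_scal_l _ K (exp base - exp base)%R).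
  apply is_lim_seq_minus'; [apply is_lim_seq_const | exact is_series_e].
Qed.

Let term_bound (n : nat) (x : R) :
  D x ->
  (Cmod (coef n * X n x) <= K * P x * e n)%R /\ (Cmod (coef n * Y n x) <= K * P x * e n)%R.
Proof.
  intros Hx. destruct (weighted_XY n) as [_ [_ B]]. destruct (B x Hx) as [BX BY].
  assert (HF := INR_fact_lt_0 n).
  assert (Q : (Cmod (coef n) * (K * (Top_bound ^ n * INR (fact n)) * (P x * hpow s n x))
               <= K * P x * e n)%R).
  { unfold coef. rewrite Cmod_div by (intros Z; apply RtoC_inj in Z; lra).
    rewrite Cmod_pow, Cmod_R, Rabs_right by lra.
    assert (HM := hpow_mono s Hs n x a Hx).
    replace (K * P x * e n)%R
      with (Cmod lambda ^ n / INR (fact n) * (K * (Top_bound ^ n * INR (fact n)) * (P x * hpow s n a)))%R.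
    - apply Rmult_le_compat_l.
      { apply Rmult_le_pos; [apply pow_le, Cmod_ge_0 |]. left. now apply Rinv_0_lt_compat. }
      apply Rmult_le_compat_l.
      { apply Rmult_le_pos; [lra |]. apply Rmult_le_pos; [| lra].
        apply pow_le. left. apply pos_Top_bound. }
      apply Rmult_le_compat_l; auto. left. apply Pw.
    - unfold e, base, hpow. rewrite !Rpow_mult_distr. field. lra. }
  split; rewrite Cmod_mult; apply Rle_trans with (2 := Q);
    (apply Rmult_le_compat_l; [apply Cmod_ge_0 | assumption]).
Qed.

(** Partial sums written as a fixpoint: [U (S N)] is then by conversion a linear combination of the
    shape used in [T_lincomb]. *)
Let U : nat -> R -> C :=
  fix U N := match N with O => X 0 | S n => fun x => U n x + coef (S n) * X (S n) x end.
Let V : nat -> R -> C :=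
  fix V N := match N with O => Y 0 | S n => fun x => V n x + coef (S n) * Y (S n) x end.

Let coef_0 : coef 0 = 1.
Proof. unfold coef. simpl. field. Qed.

Let sum_U (N : nat) (x : R) :
  sum_n (G := C_R_NormedModule) (fun n => coef n * X n x) N = U N x /\
  sum_n (G := C_R_NormedModule) (fun n => coef n * Y n x) N = V N x.
Proof.
  induction N as [| N IH].
  - rewrite !sum_O, coef_0. split; apply Cmult_1_l.
  - rewrite !sum_Sn. destruct IH as [-> ->]. split; reflexivity.
Qed.

Let series_K (x : R) : is_series (fun n => K * P x * e n)%R (K * P x * exp base)%R.
Proof. apply (is_series_scal_l (K := R_AbsRing) (K * P x)%R e). exact is_series_e. Qed.

Let uv_series (x : R) :
  D x -> is_Cseries (fun n => coef n * X n x) (u x) /\ is_Cseries (fun n => coef n * Y n x) (v x).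
Proof.
  intros Hx. split; apply (Cseries_dominated _ _ _ (fun n => proj1 (term_bound n x Hx)) (series_K x))
    || apply (Cseries_dominated _ _ _ (fun n => proj2 (term_bound n x Hx)) (series_K x)).
Qed.

Let tail (N : nat) (x : R) :
  D x -> (Cmod (u x - U N x) <= tau N * P x)%R /\ (Cmod (v x - V N x) <= tau N * P x)%R.
Proof.
  intros Hx.
  assert (E : (K * P x * exp base - sum_n (fun n => K * P x * e n) N = tau N * P x)%R).
  { assert (Q := sum_n_mult_l (K := R_Ring) (K * P x)%R e N).
    change (sum_n (fun n => K * P x * e n)%R N = K * P x * sum_n e N)%R in Q.
    rewrite Q. unfold tau. ring. }
  destruct (sum_U N x) as [<- <-]. rewrite <- E.
  split.
  - apply (Cseries_dominated _ _ _ (fun n => proj1 (term_bound n x Hx)) (series_K x)).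
  - apply (Cseries_dominated _ _ _ (fun n => proj2 (term_bound n x Hx)) (series_K x)).
Qed.

(** Brings all indices to the common weight x^kappa, where partial sums can be added. *)
Lemma weighted_XY_0 (n : nat) : exists M, (0 <= M)%R /\ weighted M 0 (X n) (Y n).
Proof.
  destruct (weighted_XY n) as [CX [CY B]].
  set (M := (K * (Top_bound ^ n * INR (fact n)))%R) in *.
  assert (HM : (0 <= M)%R).
  { apply Rmult_le_pos; [lra |]. apply Rmult_le_pos; [| apply pos_INR].
    apply pow_le. left. apply pos_Top_bound. }
  exists (M * hpow s n a)%R. split.
  { apply Rmult_le_pos; auto. left. now apply hpow_pos. }
  split; [| split]; auto. intros x Hx. destruct (B x Hx).
  assert (Q : (M * (P x * hpow s n x) <= M * hpow s n a * (P x * hpow s 0 x))%R).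
  { rewrite hpow_0.
    replace (M * hpow s n a * (P x * 1))%R with (M * (P x * hpow s n a))%R by ring.
    apply Rmult_le_compat_l; auto. apply Rmult_le_compat_l; [left; apply Pw |].
    now apply hpow_mono. }
  split; lra.
Qed.

Let weighted_U (N : nat) : exists M, (0 <= M)%R /\ weighted M 0 (U N) (V N).
Proof.
  induction N as [| N [M [HM IH]]]; [apply weighted_XY_0 |].
  destruct (weighted_XY_0 (S N)) as [M' [HM' W']].
  exists (M + Cmod (coef (S N)) * M')%R. split.
  - generalize (Rmult_le_pos _ _ (Cmod_ge_0 (coef (S N))) HM'). lra.
  - exact (weighted_lincomb _ _ _ _ _ _ _ IH W').
Qed.

Let cont_on_uv : cont_on D u /\ cont_on D v.
Proof.
  assert (L : is_lim_seq (fun N => tau N * P a)%R 0).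
  { replace 0%R with (0 * P a)%R by ring.
    apply (is_lim_seq_scal_r _ (P a) 0%R). exact tau_0. }
  (* Replacing x^kappa by a^kappa makes the remainder uniform in x. That [tau N] is nonnegative is
     read off the tail bound itself. *)
  assert (T : forall N x, D x -> (tau N * P x <= tau N * P a)%R).
  { intros N x Hx. apply Rmult_le_compat_l.
    - assert (Q := tail N x Hx). assert (HP := Pw x).
      apply Rmult_le_reg_r with (P x); auto. rewrite Rmult_0_l.
      apply Rle_trans with (2 := proj1 Q). apply Cmod_ge_0.
    - apply PP, Hx. }
  split.
  - apply (cont_on_uniform_limit D U u (fun N => tau N * P a)%R); auto.
    + intros N. destruct (weighted_U N) as [M [_ W]]. apply W.
    + intros N x Hx. apply Rle_trans with (2 := T N x Hx). exact (proj1 (tail N x Hx)).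
  - apply (cont_on_uniform_limit D V v (fun N => tau N * P a)%R); auto.
    + intros N. destruct (weighted_U N) as [M [_ W]]. apply W.
    + intros N x Hx. apply Rle_trans with (2 := T N x Hx). exact (proj2 (tail N x Hx)).
Qed.

(** Subtraction is written with the coefficient -1 so that [T_lincomb] and [weighted_lincomb] apply
    as they stand. *)
Let weighted_diff (N : nat) :
  weighted (tau N) 0 (fun x => u x + (- (1)) * U N x) (fun x => v x + (- (1)) * V N x).
Proof.
  destruct (weighted_U N) as [M [_ [CU [CV _]]]]. destruct cont_on_uv as [Cu Cv].
  split; [| split]; try (apply cont_on_plus; auto; apply cont_on_mult; auto; apply cont_on_const).
  intros x Hx. rewrite hpow_0, Rmult_1_r.
  replace (u x + - (1) * U N x) with (u x - U N x) by ring.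
  replace (v x + - (1) * V N x) with (v x - V N x) by ring. exact (tail N x Hx).
Qed.

Let tau_pos (N : nat) : (0 <= tau N)%R.
Proof.
  assert (Da : D a) by (split; lra).
  apply Rmult_le_reg_r with (P a); [apply Pw |]. rewrite Rmult_0_l.
  apply Rle_trans with (2 := proj1 (tail N a Da)). apply Cmod_ge_0.
Qed.

Let weighted_uv : exists M, (0 <= M)%R /\ weighted M 0 u v.
Proof.
  destruct (weighted_U 0) as [M [HM W]].
  exists (tau 0 + Cmod 1 * M)%R. split.
  - rewrite Cmod_1. generalize (tau_pos 0). lra.
  - generalize (weighted_lincomb _ _ _ _ _ _ 1 (weighted_diff 0) W).
    apply weighted_ext. intros x _. split; ring.
Qed.

Let U_recursion (N : nat) (x : R) :
  D x ->
  U (S N) x = f x + lambda * TX (U N) (V N) x /\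
  V (S N) x = g x + lambda * TY (U N) (V N) x.
Proof.
  intros Hx.
  (* The factor n + 1 in the recursion of the formal powers turns lambda^(n+1) / (n+1)! into lambda
     times lambda^n / n!. *)
  assert (E : forall n, coef (S n) * RtoC (INR (S n)) = lambda * coef n).
  { intros n. unfold coef. rewrite fact_simpl, mult_INR, RtoC_mult. cbn [Cpow].
    field. split; intros Z; apply RtoC_inj in Z; revert Z.
    - apply INR_fact_neq_0.
    - apply not_0_INR. discriminate. }
  induction N as [| N IH].
  - simpl U. simpl V. rewrite Xpow_S, Ypow_S, !Cmult_assoc, E, coef_0, Cmult_1_r.
    split; reflexivity.
  - destruct IH as [IHU IHV].
    destruct (weighted_U N) as [M [HM W]].
    destruct (weighted_XY_0 (S N)) as [M' [HM' W2]].
    destruct (T_lincomb M M' _ _ _ _ (coef (S N)) HM HM' W W2 x Hx) as [EX EY].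
    change (U (S (S N)) x) with (U (S N) x + coef (S (S N)) * X (S (S N)) x).
    change (V (S (S N)) x) with (V (S N) x + coef (S (S N)) * Y (S (S N)) x).
    change (TX (U (S N)) (V (S N)) x) with
      (TX (fun t => U N t + coef (S N) * X (S N) t) (fun t => V N t + coef (S N) * Y (S N) t) x).
    change (TY (U (S N)) (V (S N)) x) with
      (TY (fun t => U N t + coef (S N) * X (S N) t) (fun t => V N t + coef (S N) * Y (S N) t) x).
    rewrite EX, EY, IHU, IHV, (Xpow_S (S N)), (Ypow_S (S N)), !Cmult_assoc, E.
    split; ring.
Qed.
(* The partial sums satisfy [U_(N+1) = f + lambda T U_N]; the equation passes
   to the limit because [T] is bounded in the weighted norm. *)
Let fixed_point (x : R) :
  D x -> u x = f x + lambda * TX u v x /\ v x = g x + lambda * TY u v x.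
Proof.
  intros Hx.
  (* The defect of the fixed-point equation is split at the partial sums: [tau (S N)] P x is the
     remainder of order N + 1, and c [tau N] bounds lambda T applied to the remainder of order N. *)
  set (c := (Cmod lambda * (Top_bound * (P x * hpow s 1 x)))%R).
  assert (Hc : (0 <= c)%R).
  { apply Rmult_le_pos; [apply Cmod_ge_0 |].
    generalize (Rmult_lt_0_compat _ _ pos_Top_bound
      (Rmult_lt_0_compat _ _ (Pw x) (hpow_pos s Hs 1 x))). lra. }
  assert (L : is_lim_seq (fun N => tau (S N) * P x + c * tau N)%R 0).
  { replace 0%R with (0 * P x + c * 0)%R by ring.
    apply is_lim_seq_plus'.
    - apply (is_lim_seq_scal_r (fun N => tau (S N)) (P x) 0%R).
      apply (is_lim_seq_incr_1 tau). exact tau_0.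
    - apply (is_lim_seq_scal_l tau c 0%R). exact tau_0. }
  assert (Z : forall z : C,
    (forall N, Cmod z <= tau (S N) * P x + c * tau N)%R -> z = 0).
  { intros z Hz. apply Cmod_eq_0. apply Rle_antisym; [| apply Cmod_ge_0].
    apply (is_lim_seq_le (fun _ => Cmod z) _ (Cmod z) 0%R Hz); [apply is_lim_seq_const | exact L]. }
  assert (B : forall N,
    (Cmod (TX u v x - TX (U N) (V N) x) <= Top_bound * tau N * (P x * hpow s 1 x))%R /\
    (Cmod (TY u v x - TY (U N) (V N) x) <= Top_bound * tau N * (P x * hpow s 1 x))%R).
  { intros N. destruct weighted_uv as [M [HM W]], (weighted_U N) as [M' [HM' W']].
    destruct (T_lincomb M M' u v (U N) (V N) (- (1)) HM HM' W W' x Hx) as [E1 E2].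
    destruct (weighted_T _ _ _ _ (tau_pos N) (weighted_diff N)) as [_ [_ Q]].
    specialize (Q x Hx). rewrite E1, E2 in Q.
    replace (TX u v x - TX (U N) (V N) x) with (TX u v x + - (1) * TX (U N) (V N) x) by ring.
    replace (TY u v x - TY (U N) (V N) x) with (TY u v x + - (1) * TY (U N) (V N) x) by ring.
    exact Q. }
  assert (Q : forall z1 z2 z3 z4 h b (t r : R),
    (Cmod (z1 - z2) <= t)%R -> (Cmod (z3 - z4) <= r)%R -> z2 = h + b * z4 ->
    (Cmod (z1 - (h + b * z3)) <= t + Cmod b * r)%R).
  { intros z1 z2 z3 z4 h b t r H1 H2 ->.
    replace (z1 - (h + b * z3)) with (z1 - (h + b * z4) + - (b * (z3 - z4))) by ring.
    apply Cmod_plus_le; auto. rewrite Cmod_opp. apply Cmod_mult_le; auto. apply Rle_refl. }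
  split.
  - replace (u x) with (u x - (f x + lambda * TX u v x) + (f x + lambda * TX u v x)) by ring.
    rewrite (Z (u x - (f x + lambda * TX u v x))); [ring |]. intros N.
    replace (c * tau N)%R with (Cmod lambda * (Top_bound * tau N * (P x * hpow s 1 x)))%R
      by (unfold c; ring).
    apply Q with (U (S N) x) (TX (U N) (V N) x);
      [exact (proj1 (tail (S N) x Hx)) | exact (proj1 (B N)) | exact (proj1 (U_recursion N x Hx))].
  - replace (v x) with (v x - (g x + lambda * TY u v x) + (g x + lambda * TY u v x)) by ring.
    rewrite (Z (v x - (g x + lambda * TY u v x))); [ring |]. intros N.
    replace (c * tau N)%R with (Cmod lambda * (Top_bound * tau N * (P x * hpow s 1 x)))%R
      by (unfold c; ring).
    apply Q with (V (S N) x) (TY (U N) (V N) x);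
      [exact (proj2 (tail (S N) x Hx)) | exact (proj2 (B N)) | exact (proj2 (U_recursion N x Hx))].
Qed.

(** The derivatives are read off the fixed-point equation. The sums enter as functions with defining
    equations, so that the lemma applies both to (f_q, g_q) and to the final series. The bound on u
    - f has the surplus factor h, which makes it o(x^kappa). *)
Lemma perturbed_system (u1 v1 : R -> C) :
  (forall x, u1 x = CSeries (fun n =>
    Cpow lambda n / RtoC (INR (fact n)) * Xpow f g p2 r11 r12 r21 r22 n x)) ->
  (forall x, v1 x = CSeries (fun n =>
    Cpow lambda n / RtoC (INR (fact n)) * Ypow f g p2 r11 r12 r21 r22 n x)) ->
  (forall x, Ioc a x ->
     is_Cseries (fun n =>
       Cpow lambda n / RtoC (INR (fact n)) * Xpow f g p2 r11 r12 r21 r22 n x) (u1 x) /\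
     is_Cseries (fun n =>
       Cpow lambda n / RtoC (INR (fact n)) * Ypow f g p2 r11 r12 r21 r22 n x) (v1 x)) /\
  (forall x, Ioc a x ->
     is_derive_on (Ioc a) u1 x
       (sigma x * u1 x + p2 x * v1 x - lambda * (r21 x * u1 x + r22 x * v1 x)) /\
     is_derive_on (Ioc a) v1 x
       (- (p1 x * u1 x) - sigma x * v1 x + lambda * (r11 x * u1 x + r12 x * v1 x))) /\
  exists M : R, forall x, Ioc a x ->
    (Cmod (u1 x - f x) <= M * (Rpower x kappa * hpow s 1 x))%R /\
    (Cmod (v1 x) <= M * Rpower x kappa)%R.
Proof.
  intros EU EV.
  replace u1 with u by (apply functional_extensionality; intros; symmetry; apply EU).
  replace v1 with v by (apply functional_extensionality; intros; symmetry; apply EV).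
  split; [exact uv_series |].
  change ((forall x, D x ->
     is_derive_on D u x
       (sigma x * u x + p2 x * v x - lambda * (r21 x * u x + r22 x * v x)) /\
     is_derive_on D v x
       (- (p1 x * u x) - sigma x * v x + lambda * (r11 x * u x + r12 x * v x))) /\
    exists M : R, forall x, D x ->
      (Cmod (u x - f x) <= M * (P x * hpow s 1 x))%R /\ (Cmod (v x) <= M * P x)%R).
  destruct weighted_uv as [M [HM W]]. split.
  - intros x Hx. destruct (fixed_point x Hx) as [Eu Ev]. split.
    + apply is_derive_on_ext with (fun x => f x + lambda * TX u v x); auto.
      { intros y Hy. symmetry. exact (proj1 (fixed_point y Hy)). }
      replace (sigma x * u x + p2 x * v x - lambda * (r21 x * u x + r22 x * v x)) with
        (sigma x * f x + p2 x * g x + lambda *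
          (sigma x * TX u v x + p2 x * TY u v x - (r21 x * u x + r22 x * v x))).
      2: { rewrite Eu at 2. rewrite Ev at 2. ring. }
      apply is_derive_on_plus; auto. apply is_derive_on_scal; auto.
      now apply (TX_derive M 0).
    + apply is_derive_on_ext with (fun x => g x + lambda * TY u v x); auto.
      { intros y Hy. symmetry. exact (proj2 (fixed_point y Hy)). }
      replace (- (p1 x * u x) - sigma x * v x + lambda * (r11 x * u x + r12 x * v x)) with
        (- (p1 x * f x) - sigma x * g x + lambda *
          (- (p1 x * TX u v x) - sigma x * TY u v x + (r11 x * u x + r12 x * v x))).
      2: { rewrite Eu at 2. rewrite Ev at 2. ring. }
      apply is_derive_on_plus; auto. apply is_derive_on_scal; auto.
      now apply (TY_derive M 0).
  - destruct (weighted_T M 0 u v HM W) as [_ [_ BT]].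
    destruct W as [_ [_ BW]].
    assert (HT := pos_Top_bound).
    exists (Cmod lambda * (Top_bound * M) + M)%R. intros x Hx.
    assert (Q : (0 <= Cmod lambda * (Top_bound * M))%R).
    { apply Rmult_le_pos; [apply Cmod_ge_0 | nra]. }
    assert (HP := Pw x). assert (HH1 := hpow_pos s Hs 1 x).
    rewrite Rmult_plus_distr_r. split.
    + destruct (fixed_point x Hx) as [-> _].
      replace (f x + lambda * TX u v x - f x) with (lambda * TX u v x) by ring.
      assert (0 <= M * (P x * hpow s 1 x))%R by (apply Rmult_le_pos; nra).
      assert (Cmod (lambda * TX u v x) <= Cmod lambda * (Top_bound * M * (P x * hpow s 1 x)))%R.
      { apply Cmod_mult_le; [apply Rle_refl |]. now apply BT. }
      lra.
    + destruct (BW x Hx) as [_ BV]. rewrite hpow_0, Rmult_1_r in BV.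
      rewrite Rmult_plus_distr_r.
      assert (0 <= Cmod lambda * (Top_bound * M) * P x)%R by (apply Rmult_le_pos; lra). lra.
Qed.

End Series.

End Operator.

(** * Behaviour at the origin *)

Lemma rpow_neq_0 (y x : R) : rpow y x <> 0.
Proof. intros E. apply RtoC_inj in E. generalize (Rpower_pos x y). lra. Qed.

Lemma rpow_plus (y z x : R) : rpow (y + z) x = rpow y x * rpow z x.
Proof. unfold rpow. now rewrite Rpower_plus, RtoC_mult. Qed.

Lemma rpow_1 (x : R) : (0 < x)%R -> rpow 1 x = RtoC x.
Proof. intros. unfold rpow. now rewrite Rpower_1. Qed.

Lemma rpow_opp (y x : R) : rpow (- y) x = / rpow y x.
Proof.
  unfold rpow. rewrite Rpower_Ropp, RtoC_inv; auto.
  generalize (Rpower_pos x y). lra.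
Qed.

Lemma Cmod_rpow (y x : R) : Cmod (rpow y x) = Rpower x y.
Proof.
  unfold rpow. rewrite Cmod_R, Rabs_right; auto. apply Rle_ge, Rlt_le, Rpower_pos.
Qed.

Lemma is_derive_on_rpow (D : R -> Prop) (y x : R) :
  D x -> (0 < x)%R -> is_derive_on D (rpow y) x (RtoC (y / x) * rpow y x).
Proof.
  intros Dx Hx.
  replace (RtoC (y / x) * rpow y x) with (RtoC (y * Rpower x (y - 1))).
  - apply is_derive_on_RtoC; auto. now apply is_derive_Rpower.
  - unfold rpow. rewrite <- RtoC_mult. f_equal. unfold Rminus.
    rewrite Rpower_plus, Rpower_Ropp, Rpower_1 by auto. field. lra.
Qed.

Lemma is_derive_Rpower_S (y x : R) :
  (0 < y + 1)%R -> (0 < x)%R ->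
  is_derive (fun t => Rpower t (y + 1) / (y + 1))%R x (Rpower x y).
Proof.
  intros Hy Hx.
  apply (is_derive_ext (fun t => / (y + 1) * Rpower t (y + 1))%R).
  { intros t. apply Rmult_comm. }
  evar_last.
  - apply is_derive_scal. now apply is_derive_Rpower.
  - replace (y + 1 - 1)%R with y by ring. field. lra.
Qed.

Lemma filterlim_Rplus_0 (G H : R -> R) (F : (R -> Prop) -> Prop) :
  Filter F -> filterlim G F (locally 0%R) -> filterlim H F (locally 0%R) ->
  filterlim (fun x => G x + H x)%R F (locally 0%R).
Proof.
  intros FF HG HH. replace 0%R with (0 + 0)%R by ring.
  apply (filterlim_comp_2 (I := locally (0 + 0)%R) G H Rplus HG HH).
  apply (filterlim_plus (V := R_NormedModule) 0%R 0%R).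
Qed.

Lemma cont_on_at_right (a : R) (r : R -> C) :
  (0 < a)%R -> cont_on (Icc a) r ->
  filterlim r (at_right 0) (locally (T := C_UniformSpace) (r 0%R)).
Proof.
  intros Ha H. assert (I0 : Icc a 0) by (split; lra).
  intros P HP. specialize (H 0%R I0 P HP). destruct H as [d Hd].
  apply at_right_0_iff. exists (Rmin d a). split.
  { apply Rmin_glb_lt; auto. apply cond_pos. }
  intros x Hx. assert (H1 := Rmin_l d a). assert (H2 := Rmin_r d a).
  apply Hd; [| split; lra].
  change (Rabs (x - 0) < d)%R. rewrite Rminus_0_r, Rabs_right; lra.
Qed.

Lemma filterlim_C_bounded (F : R -> C) (l : C) :
  filterlim F (at_right 0) (locally (T := C_UniformSpace) l) -> bounded_at_0 F.
Proof.
  intros H. rewrite filterlim_C_iff in H by typeclasses eauto.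
  exists (1 + Cmod l)%R. generalize (H 1%R Rlt_0_1). apply filter_imp. intros x Hx.
  replace (F x) with ((F x - l) + l) by ring.
  apply Cmod_plus_le; [lra | apply Rle_refl].
Qed.

(** Compactness of [b,a] away from 0, the given bound near 0. It supplies the global constants for f
    / x^kappa and its inverse. *)
Lemma bounded_on_Ioc (a : R) (F : R -> C) :
  (0 < a)%R -> cont_on (Ioc a) F -> bounded_at_0 F ->
  exists M, (0 <= M)%R /\ forall x, Ioc a x -> (Cmod (F x) <= M)%R.
Proof.
  intros Ha CF [M0 H0]. apply at_right_0_iff in H0. destruct H0 as [d [Hd H0]].
  set (b := Rmin (d / 2) a).
  assert (Hb1 := Rmin_l (d / 2) a). assert (Hb2 := Rmin_r (d / 2) a). fold b in Hb1, Hb2.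
  assert (Hb : (0 < b)%R) by (apply Rmin_glb_lt; lra).
  destruct (continuity_ab_maj (fun t => Cmod (F (Rmin a t))) b a Hb2) as [m [Hm _]].
  { intros t Ht. apply continuity_pt_filterlim.
    apply (filterlim_comp _ _ _ (fun t => F (Rmin a t)) Cmod (locally t)
      (locally (T := C_UniformSpace) (F (Rmin a t)))).
    - apply (cont_on_Rmin a a F t); auto; lra.
    - apply (filterlim_ext (fun z : C => norm (z : C_R_NormedModule))).
      { intros z. symmetry. apply Cmod_norm. }
      rewrite Cmod_norm. apply (filterlim_norm (V := C_R_NormedModule)). }
  exists (Rmax M0 (Cmod (F (Rmin a m)))). split.
  { apply Rle_trans with (2 := Rmax_r _ _). apply Cmod_ge_0. }
  intros x [Hx1 Hx2]. destruct (Rlt_le_dec x b) as [Hxb | Hxb].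
  - apply Rle_trans with (2 := Rmax_l _ _). apply H0. lra.
  - apply Rle_trans with (2 := Rmax_r _ _).
    specialize (Hm x (conj Hxb Hx2)). rewrite (Rmin_right a x) in Hm by lra. exact Hm.
Qed.

Lemma bounded_on_Icc (a : R) (r : R -> C) :
  (0 < a)%R -> cont_on (Icc a) r ->
  cont_on (Ioc a) r /\ exists M, (0 <= M)%R /\ forall x, Ioc a x -> (Cmod (r x) <= M)%R.
Proof.
  intros Ha H.
  assert (C1 : cont_on (Ioc a) r).
  { apply cont_on_subset with (2 := H). intros x [H1 H2]. split; lra. }
  split; auto. apply bounded_on_Ioc; auto.
  eapply filterlim_C_bounded, cont_on_at_right; eauto.
Qed.

Lemma filterlim_C_eq (F : (R -> Prop) -> Prop) (f : R -> C) (l m : C) :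
  filterlim f F (locally (T := C_UniformSpace) l) -> l = m ->
  filterlim f F (locally (T := C_UniformSpace) m).
Proof. now intros H <-. Qed.

Lemma asymp_of_limit (h w : R -> C) (c : C) :
  c <> 0 -> (forall x, w x <> 0) ->
  filterlim (fun x => h x / w x) (at_right 0) (locally (T := C_UniformSpace) c) ->
  asymp h (fun x => c * w x).
Proof.
  intros Nc Nw L. exists (fun x => / c * (h x / w x) + - (1)). split.
  - apply filterlim_C_eq with (/ c * c + - (1)); [| field; auto].
    apply filterlim_Cplus; [typeclasses eauto | | apply filterlim_const].
    apply filterlim_Cmult; [typeclasses eauto | apply filterlim_const | exact L].
  - apply filter_forall. intros x. field. auto.
Qed.

Lemma little_o_of_limit (h w : R -> C) :
  (forall x, w x <> 0) ->
  filterlim (fun x => h x / w x) (at_right 0) (locally (T := C_UniformSpace) (RtoC 0)) ->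
  little_o h w.
Proof.
  intros Nw L. exists (fun x => h x / w x). split; auto.
  apply filter_forall. intros x. field. auto.
Qed.

Lemma limit_of_asymp (h w : R -> C) (c : C) :
  (forall x, w x <> 0) -> asymp h (fun x => c * w x) ->
  filterlim (fun x => h x / w x) (at_right 0) (locally (T := C_UniformSpace) c).
Proof.
  intros Nw [e [L H]].
  apply filterlim_ext_loc with (fun x => c * (1 + e x)).
  - revert H. apply filter_imp. intros x ->. field. auto.
  - apply filterlim_C_eq with (c * (1 + 0)); [| ring].
    apply filterlim_Cmult; [typeclasses eauto | apply filterlim_const |].
    apply filterlim_Cplus; [typeclasses eauto | apply filterlim_const | exact L].
Qed.

Lemma limit_of_little_o (h w : R -> C) :
  (forall x, w x <> 0) -> little_o h w ->
  filterlim (fun x => h x / w x) (at_right 0) (locally (T := C_UniformSpace) (RtoC 0)).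
Proof.
  intros Nw [e [L H]].
  apply filterlim_ext_loc with e; auto.
  revert H. apply filter_imp. intros x ->. field. auto.
Qed.

(** * Regular solutions of the singular system *)

(** The target limit is usually an evar, assembled from limits in the context and simplified
    afterwards through [filterlim_C_eq]. Leaves are compared syntactically, so that no unfolding
    selects a wrong hypothesis. *)
Ltac Climit :=
  lazymatch goal with
  | |- filterlim (fun x => Cplus (@?f x) (@?g x)) ?F _ =>
      apply (filterlim_Cplus F f g); Climit
  | |- filterlim (fun x => Cmult (@?f x) (@?g x)) ?F _ =>
      apply (filterlim_Cmult F f g); Climit
  | |- filterlim (fun x => Copp (@?f x)) ?F _ =>
      apply (filterlim_Copp F f); Climit
  | _ =>
      match goal with
      | H : filterlim ?f _ _ |- filterlim ?g _ _ =>
          first [ constr_eq f g | constr_eq (fun x => f x) g ]; exact H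
      | _ => apply filterlim_const
      end
  end.

Ltac Ccontinuous :=
  lazymatch goal with
  | |- cont_on ?D (fun x => Cplus (@?f x) (@?g x)) => apply (cont_on_plus D f g); Ccontinuous
  | |- cont_on ?D (fun x => Cminus (@?f x) (@?g x)) => apply (cont_on_minus D f g); Ccontinuous
  | |- cont_on ?D (fun x => Cmult (@?f x) (@?g x)) => apply (cont_on_mult D f g); Ccontinuous
  | |- cont_on ?D (fun x => Copp (@?f x)) => apply (cont_on_opp D f); Ccontinuous
  | _ =>
      match goal with
      | H : cont_on ?D ?f |- cont_on ?D ?g =>
          first [ constr_eq f g | constr_eq (fun x => f x) g ]; exact H
      | _ => apply cont_on_const
      end
  end.

(** Since alpha <= 0, (x / a)^alpha is at least 1 on (0,a]; bounded coefficients therefore fit under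
    the same weight as q. *)
Lemma weight_bound (a alpha M x : R) :
  (0 < a)%R -> (alpha <= 0)%R -> (0 <= M)%R -> Ioc a x ->
  (M <= M * Rpower a (- alpha) * Rpower x alpha)%R.
Proof.
  intros Ha Hal HM [Hx1 Hx2].
  assert (Rpower x (- alpha) <= Rpower a (- alpha))%R by (apply Rle_Rpower_l; lra).
  assert (E : (Rpower x (- alpha) * Rpower x alpha = 1)%R).
  { rewrite <- Rpower_plus. replace (- alpha + alpha)%R with 0%R by ring.
    now apply Rpower_O. }
  assert (H1 := Rpower_pos x alpha).
  rewrite Rmult_assoc. rewrite <- (Rmult_1_r M) at 1. apply Rmult_le_compat_l; auto.
  rewrite <- E. apply Rmult_le_compat_r; lra.
Qed.

Section System.
Variables (a kappa alpha cq : R) (p1 p2 r11 r12 r21 r22 q : R -> C) (lambda : C).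
Hypothesis Ha : (0 < a)%R.
Hypothesis Hkappa : (1 / 2 <= kappa)%R.
Hypothesis Cp1 : cont_on (Icc a) p1.
Hypothesis Cp2 : cont_on (Icc a) p2.
Hypothesis Cr11 : cont_on (Icc a) r11.
Hypothesis Cr12 : cont_on (Icc a) r12.
Hypothesis Cr21 : cont_on (Icc a) r21.
Hypothesis Cr22 : cont_on (Icc a) r22.
Hypothesis Cq : cont_on (Ioc a) q.
Hypothesis Hcq : (0 < cq)%R.
Hypothesis Halpha : (-1 < alpha <= 0)%R.
Hypothesis Bq : forall x : R, Ioc a x -> (Cmod (q x) <= cq * Rpower x alpha)%R.

Let s : R := (alpha + 1)%R.
Let Hs : (0 < s)%R.
Proof. unfold s. lra. Qed.

Definition sigma (x : R) : C := RtoC (kappa / x) + q x.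
Definition rhs_u (u v : R -> C) (x : R) : C :=
  sigma x * u x + p2 x * v x - lambda * (r21 x * u x + r22 x * v x).
Definition rhs_v (u v : R -> C) (x : R) : C :=
  - (p1 x * u x) - sigma x * v x + lambda * (r11 x * u x + r12 x * v x).

Lemma coefficient_bound :
  exists K, (1 <= K)%R /\ forall x, Ioc a x ->
    (Cmod (q x) <= K * Rpower x (s - 1))%R /\ (Cmod (p1 x) <= K * Rpower x (s - 1))%R /\
    (Cmod (p2 x) <= K * Rpower x (s - 1))%R /\
    (Cmod (r11 x) <= K * Rpower x (s - 1))%R /\ (Cmod (r12 x) <= K * Rpower x (s - 1))%R /\
    (Cmod (r21 x) <= K * Rpower x (s - 1))%R /\ (Cmod (r22 x) <= K * Rpower x (s - 1))%R.
Proof.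
  replace (s - 1)%R with alpha by (unfold s; ring).
  destruct (bounded_on_Icc a p1 Ha Cp1) as [_ [M1 [P1 B1]]].
  destruct (bounded_on_Icc a p2 Ha Cp2) as [_ [M2 [P2 B2]]].
  destruct (bounded_on_Icc a r11 Ha Cr11) as [_ [M3 [P3 B3]]].
  destruct (bounded_on_Icc a r12 Ha Cr12) as [_ [M4 [P4 B4]]].
  destruct (bounded_on_Icc a r21 Ha Cr21) as [_ [M5 [P5 B5]]].
  destruct (bounded_on_Icc a r22 Ha Cr22) as [_ [M6 [P6 B6]]].
  set (M := (M1 + M2 + M3 + M4 + M5 + M6)%R).
  exists (1 + cq + M * Rpower a (- alpha))%R.
  assert (HM : (0 <= M * Rpower a (- alpha))%R).
  { apply Rmult_le_pos; [unfold M; lra |]. left. apply Rpower_pos. }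
  split; [lra |]. intros x Hx.
  assert (Hw := weight_bound a alpha M x Ha (proj2 Halpha) ltac:(unfold M; lra) Hx).
  assert (Hp := Rpower_pos x alpha).
  assert (Q : (M * Rpower a (- alpha) * Rpower x alpha
               <= (1 + cq + M * Rpower a (- alpha)) * Rpower x alpha)%R).
  { apply Rmult_le_compat_r; lra. }
  assert (Q' : (M <= (1 + cq + M * Rpower a (- alpha)) * Rpower x alpha)%R) by lra.
  specialize (B1 x Hx). specialize (B2 x Hx). specialize (B3 x Hx).
  specialize (B4 x Hx). specialize (B5 x Hx). specialize (B6 x Hx).
  split; [| unfold M in Q' at 1; repeat split; lra].
  apply Rle_trans with (1 := Bq x Hx). apply Rmult_le_compat_r; lra.
Qed.

Lemma cont_on_sigma : cont_on (Ioc a) sigma.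
Proof.
  apply cont_on_plus; auto. apply cont_on_RtoC. intros x [Hx _].
  apply (ex_derive_continuous (fun x => kappa / x)%R).
  exists (- kappa / x ^ 2)%R. auto_derive; [lra | field; lra].
Qed.

Lemma cont_on_rhs (u v : R -> C) :
  cont_on (Ioc a) u -> cont_on (Ioc a) v ->
  cont_on (Ioc a) (rhs_u u v) /\ cont_on (Ioc a) (rhs_v u v).
Proof.
  intros Cu Cv. assert (Cs := cont_on_sigma).
  assert (C1 := proj1 (bounded_on_Icc a p1 Ha Cp1)).
  assert (C2 := proj1 (bounded_on_Icc a p2 Ha Cp2)).
  assert (C3 := proj1 (bounded_on_Icc a r11 Ha Cr11)).
  assert (C4 := proj1 (bounded_on_Icc a r12 Ha Cr12)).
  assert (C5 := proj1 (bounded_on_Icc a r21 Ha Cr21)).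
  assert (C6 := proj1 (bounded_on_Icc a r22 Ha Cr22)).
  split; unfold rhs_u, rhs_v; Ccontinuous.
Qed.

(** * Sharp asymptotics at the origin of a solution with u ~ x^kappa and v = O(x^kappa) *)

Section Asymptotics.
Variables u v : R -> C.
Hypothesis Du : forall x, Ioc a x -> is_derive_on (Ioc a) u x (rhs_u u v x).
Hypothesis Dv : forall x, Ioc a x -> is_derive_on (Ioc a) v x (rhs_v u v x).
Hypothesis Lu :
  filterlim (fun x => u x / rpow kappa x) (at_right 0) (locally (T := C_UniformSpace) (RtoC 1)).
Hypothesis Bv : exists M, forall x, Ioc a x -> (Cmod (v x) <= M * Rpower x kappa)%R.

(** The factor x^kappa cancels the term with kappa/x and leaves W' = x^(2 kappa) cA + cB W, where cA
    tends to A0 = (2 kappa + 1) mu and cB is only O(x^alpha). *)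
Let W (x : R) : C := rpow kappa x * v x.
Let cA (x : R) : C := (lambda * r11 x + - p1 x) * (u x / rpow kappa x).
Let cB (x : R) : C := - q x + lambda * r12 x.
Let A0 : C := lambda * r11 0%R - p1 0%R.

Let W_derive (x : R) :
  Ioc a x -> is_derive_on (Ioc a) W x (rpow (2 * kappa) x * cA x + cB x * W x).
Proof.
  intros Hx.
  replace (rpow (2 * kappa) x * cA x + cB x * W x) with
    (RtoC (kappa / x) * rpow kappa x * v x + rpow kappa x * rhs_v u v x).
  - apply is_derive_on_mult; auto. apply is_derive_on_rpow; auto. apply Hx.
  - replace (2 * kappa)%R with (kappa + kappa)%R by ring. rewrite rpow_plus.
    unfold cA, cB, W, rhs_v, sigma. field. apply rpow_neq_0.
Qed.

Let cA_limit : filterlim cA (at_right 0) (locally (T := C_UniformSpace) A0).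
Proof.
  assert (L1 := cont_on_at_right a p1 Ha Cp1).
  assert (L2 := cont_on_at_right a r11 Ha Cr11).
  apply filterlim_C_eq with ((lambda * r11 0%R + - p1 0%R) * 1); [| unfold A0; ring].
  unfold cA. Climit.
Qed.

Let cA_bound : exists C, (0 <= C)%R /\ forall x, Ioc a x -> (Cmod (cA x) <= C)%R.
Proof.
  apply bounded_on_Ioc; auto; [| exact (filterlim_C_bounded _ _ cA_limit)].
  assert (C1 := proj1 (bounded_on_Icc a p1 Ha Cp1)).
  assert (C3 := proj1 (bounded_on_Icc a r11 Ha Cr11)).
  assert (Cu := is_derive_on_cont_on _ _ _ Du).
  apply cont_on_mult.
  - apply cont_on_plus; [| now apply cont_on_opp].
    apply cont_on_mult; auto. apply cont_on_const.
  - apply cont_on_div; auto; [| apply cont_on_Rpower]. intros. apply rpow_neq_0.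
Qed.

Let cB_bound :
  exists C, (0 < C)%R /\ forall x, Ioc a x -> (Cmod (cB x) <= C * Rpower x (s - 1))%R.
Proof.
  destruct coefficient_bound as [K [HK B]].
  exists (K + Cmod lambda * K)%R. split.
  - generalize (Rmult_le_pos _ K (Cmod_ge_0 lambda) ltac:(lra)). lra.
  - intros x Hx. destruct (B x Hx) as [H1 [_ [_ [_ [H2 _]]]]].
    rewrite Rmult_plus_distr_r, Rmult_assoc. apply Cmod_plus_le.
    + now rewrite Cmod_opp.
    + apply Cmod_mult_le; auto. apply Rle_refl.
Qed.

Let W_bound : exists M, (0 <= M)%R /\
  forall x, Ioc a x -> (Cmod (W x) <= M * Rpower x (2 * kappa))%R.
Proof.
  destruct Bv as [M BM]. exists M. split.
  - assert (Ia : Ioc a a) by (split; lra).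
    generalize (Cmod_ge_0 (v a)) (BM a Ia) (Rpower_pos a kappa). nra.
  - intros x Hx. replace (2 * kappa)%R with (kappa + kappa)%R by ring.
    rewrite Rpower_plus.
    replace (M * (Rpower x kappa * Rpower x kappa))%R
      with (Rpower x kappa * (M * Rpower x kappa))%R by ring.
    apply Cmod_mult_le; auto. rewrite Cmod_rpow. apply Rle_refl.
Qed.

Let W_0 : filterlim W (at_right 0) (locally (T := C_UniformSpace) (RtoC 0)).
Proof.
  destruct W_bound as [M [HM B]].
  apply filterlim_0_dominated with (fun x => M * Rpower x (2 * kappa))%R.
  - apply at_right_0_iff. exists a. split; auto. intros x Hx. apply B. split; lra.
  - apply filterlim_Rmult_0, filterlim_Rpower_0. lra.
Qed.

(* On a short interval the term [cB W] can be absorbed: a bound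
   [C + B] of [W] self-improves to [C + B / 2]. *)
Let W_bound_improved :
  exists C d, (0 <= C)%R /\ (0 < d <= a)%R /\
    forall x, (0 < x <= d)%R -> (Cmod (W x) <= C * Rpower x (2 * kappa + 1))%R.
Proof.
  destruct cA_bound as [CA [HA BA]], cB_bound as [CB [HB BB]], W_bound as [M [HM BM]].
  (* As h tends to 0, a d exists with CB h <= 1/2 on (0,d]; this yields the halving. *)
  assert (Hd := filterlim_Rmult_0 (2 * CB) _ _ (filterlim_hpow_0 s Hs 0)).
  assert (Hd' := proj1 (filterlim_locally _ 0%R) Hd (mkposreal _ Rlt_0_1)).
  apply at_right_0_iff in Hd'. destruct Hd' as [d0 [Hd0 Hd']].
  set (d := Rmin (d0 / 2) a).
  assert (Hm1 := Rmin_l (d0 / 2) a). assert (Hm2 := Rmin_r (d0 / 2) a). fold d in Hm1, Hm2.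
  assert (Pd : (0 < d)%R) by (apply Rmin_glb_lt; lra).
  exists (2 * CA)%R, d. repeat split; try lra. intros x Hx.
  assert (Small : (CB * hpow s 1 x <= / 2)%R).
  { assert (Hh := Hd' x ltac:(lra)).
    change (Rabs (2 * CB * hpow s 1 x - 0) < 1)%R in Hh. apply Rabs_def2 in Hh. lra. }
  set (N := (2 * CA * Rpower x (2 * kappa + 1))%R).
  assert (HN : (0 <= N)%R).
  { apply Rmult_le_pos; [lra |]. left. apply Rpower_pos. }
  set (B0 := (M * Rpower x (2 * kappa))%R).
  assert (HB0 : (0 <= B0)%R).
  { apply Rmult_le_pos; [lra |]. left. apply Rpower_pos. }
  (* x is fixed, and the bound is improved on the whole of (0,x] with constants taken at x; letting
     n grow at t = x leaves N. *)
  assert (It : forall n t, (0 < t <= x)%R -> (Cmod (W t) <= N + B0 * (/ 2) ^ n)%R).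
  { induction n as [| n IH]; intros t Ht.
    - rewrite pow_O, Rmult_1_r. apply Rle_trans with B0; [| lra].
      apply Rle_trans with (1 := BM t ltac:(split; lra)). apply Rmult_le_compat_l; auto.
      apply Rle_Rpower_l; lra.
    - set (B := (N + B0 * (/ 2) ^ n)%R) in *.
      assert (PB : (0 <= B)%R).
      { apply Rplus_le_le_0_compat; auto. apply Rmult_le_pos; auto. apply pow_le. lra. }
      (* The two terms integrate the bounds of x^(2 kappa) cA and of cB W. The first is at most N /
         2 because 2 kappa + 1 >= 1, the second at most B / 2. *)
      set (G := fun y => (CA * (Rpower y (2 * kappa + 1) / (2 * kappa + 1))
                          + CB * B * hpow s 1 y)%R).
      assert (HG : (Cmod (W t - 0) <= G t)%R).
      { apply (mean_value_inequality_0 a x W _ G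
          (fun y => CA * Rpower y (2 * kappa) + CB * B * (Rpower y (s - 1) * hpow s 0 y))%R
          0 t W_derive); auto; try lra.
        - intros y Hy.
          apply (is_derive_plus (fun y => CA * (Rpower y (2 * kappa + 1) / (2 * kappa + 1)))%R
                   (fun y => CB * B * hpow s 1 y)%R).
          + apply is_derive_scal. apply is_derive_Rpower_S; lra.
          + apply is_derive_scal. now apply is_derive_hpow.
        - apply filterlim_Rplus_0; [typeclasses eauto | |].
          + apply filterlim_Rmult_0.
            apply (filterlim_ext (fun y => / (2 * kappa + 1) * Rpower y (2 * kappa + 1))%R).
            { intros y. apply Rmult_comm. }
            apply filterlim_Rmult_0, filterlim_Rpower_0. lra.
          + apply filterlim_Rmult_0. now apply filterlim_hpow_0.
        - intros y Hy. assert (Iy : Ioc a y) by (split; lra).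
          rewrite hpow_0, Rmult_1_r. apply Cmod_plus_le.
          + rewrite (Rmult_comm CA). apply Cmod_mult_le; auto. rewrite Cmod_rpow. apply Rle_refl.
          + replace (CB * B * Rpower y (s - 1))%R with (CB * Rpower y (s - 1) * B)%R by ring.
            apply Cmod_mult_le; auto. }
      replace (W t - 0) with (W t) in HG by ring.
      apply Rle_trans with (1 := HG). unfold G.
      assert (G1 : (Rpower t (2 * kappa + 1) / (2 * kappa + 1) <= Rpower x (2 * kappa + 1))%R).
      { apply Rle_trans with (Rpower t (2 * kappa + 1)); [| apply Rle_Rpower_l; lra].
        assert (P1 := Rpower_pos t (2 * kappa + 1)).
        apply Rle_div_l; [lra |]. nra. }
      assert (G2 : (CB * hpow s 1 t <= / 2)%R).
      { apply Rle_trans with (2 := Small). apply Rmult_le_compat_l; [lra |].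
        apply hpow_mono; auto. }
      assert (G3 : (CA * (Rpower t (2 * kappa + 1) / (2 * kappa + 1)) <= N / 2)%R).
      { unfold N. apply Rle_trans with (CA * Rpower x (2 * kappa + 1))%R; [| lra].
        now apply Rmult_le_compat_l. }
      assert (G4 : (CB * B * hpow s 1 t <= / 2 * B)%R).
      { replace (CB * B * hpow s 1 t)%R with (CB * hpow s 1 t * B)%R by ring.
        now apply Rmult_le_compat_r. }
      replace (N + B0 * (/ 2) ^ S n)%R with (N / 2 + / 2 * B)%R by (unfold B; simpl; field).
      lra. }
  assert (L : is_lim_seq (fun n => N + B0 * (/ 2) ^ n)%R (N + B0 * 0)%R).
  { apply is_lim_seq_plus'; [apply is_lim_seq_const |].
    apply (is_lim_seq_scal_l (fun n => (/ 2) ^ n)%R B0 0%R).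
    apply is_lim_seq_geom. rewrite Rabs_right; lra. }
  rewrite Rmult_0_r, Rplus_0_r in L.
  apply (is_lim_seq_le (fun _ => Cmod (W x)) _ (Cmod (W x)) N
    (fun n => It n x ltac:(lra)) (is_lim_seq_const _) L).
Qed.

Let m : C := mu kappa p1 r11 lambda.

(** The function W - mu x^(2 kappa + 1) has derivative x^(2 kappa) (cA - A0) + cB W. By the improved
    bound of W the last term is x^(2 kappa) O(x^(alpha+1)), so the whole derivative is o(x^(2
    kappa)) and integrates to o(x^(2 kappa + 1)). *)
Let v_limit :
  filterlim (fun x => v x / rpow (kappa + 1) x) (at_right 0) (locally (T := C_UniformSpace) m).
Proof.
  rewrite filterlim_C_iff by typeclasses eauto. intros eps He.
  destruct cB_bound as [CB [HB BB]], W_bound_improved as [CW [d [HC [Hd BW]]]].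
  assert (He2 : (0 < eps / 2)%R) by lra.
  assert (L1 := proj1 (filterlim_C_iff _ _ _ _ _) cA_limit _ He2).
  assert (L2 := filterlim_Rmult_0 (CB * CW) _ _ (filterlim_Rpower_0 s Hs)).
  assert (L2' := proj1 (filterlim_locally _ 0%R) L2 (mkposreal _ He2)).
  assert (L := filter_and _ _ L1 L2'). apply at_right_0_iff in L.
  destruct L as [d' [Hd' L]].
  apply at_right_0_iff. exists (Rmin d d').
  assert (Hm1 := Rmin_l d d'). assert (Hm2 := Rmin_r d d').
  split; [apply Rmin_glb_lt; lra |]. intros x Hx.
  assert (F : (Cmod (W x - m * rpow (2 * kappa + 1) x - 0)
               <= eps * (Rpower x (2 * kappa + 1) / (2 * kappa + 1)))%R).
  { apply (mean_value_inequality_0 a x (fun x => W x - m * rpow (2 * kappa + 1) x)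
      (fun x => rpow (2 * kappa) x * cA x + cB x * W x
        - m * (RtoC ((2 * kappa + 1) / x) * rpow (2 * kappa + 1) x))
      (fun x => eps * (Rpower x (2 * kappa + 1) / (2 * kappa + 1)))%R
      (fun x => eps * Rpower x (2 * kappa))%R 0 x); try lra.
    - intros t Ht. apply is_derive_on_minus; auto. apply is_derive_on_scal; auto.
      apply is_derive_on_rpow; auto. apply Ht.
    - intros t Ht. apply is_derive_scal. apply is_derive_Rpower_S; lra.
    - apply filterlim_C_eq with (0 + - (m * 0)); [| ring].
      assert (Lr : filterlim (rpow (2 * kappa + 1)) (at_right 0)
                     (locally (T := C_UniformSpace) (RtoC 0))).
      { apply filterlim_RtoC; [typeclasses eauto |]. apply filterlim_Rpower_0. lra. }
      unfold Cminus. apply (filterlim_Cplus (at_right 0) W); [exact W_0 |].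
      apply (filterlim_Copp (at_right 0)).
      apply (filterlim_Cmult (at_right 0)); [apply filterlim_const | exact Lr].
    - apply filterlim_Rmult_0.
      apply (filterlim_ext (fun y => / (2 * kappa + 1) * Rpower y (2 * kappa + 1))%R).
      { intros y. apply Rmult_comm. }
      apply filterlim_Rmult_0, filterlim_Rpower_0. lra.
    - intros t Ht. destruct (L t ltac:(lra)) as [H1 H2].
      change (Rabs (CB * CW * Rpower t s - 0) < eps / 2)%R in H2. apply Rabs_def2 in H2.
      replace (rpow (2 * kappa) t * cA t + cB t * W t
        - m * (RtoC ((2 * kappa + 1) / t) * rpow (2 * kappa + 1) t))
        with (rpow (2 * kappa) t * (cA t - A0) + cB t * W t).
      2: { rewrite rpow_plus, rpow_1 by lra. unfold m, mu. fold A0.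
           rewrite RtoC_div by lra. field. split; intros Z; apply RtoC_inj in Z; lra. }
      apply Rle_trans with (Rpower t (2 * kappa) * (eps / 2)
        + CB * Rpower t (s - 1) * (CW * Rpower t (2 * kappa + 1)))%R.
      + apply Cmod_plus_le.
        * apply Cmod_mult_le; [rewrite Cmod_rpow; apply Rle_refl | lra].
        * apply Cmod_mult_le; [apply BB; split; lra | apply BW; lra].
      + replace (CB * Rpower t (s - 1) * (CW * Rpower t (2 * kappa + 1)))%R
          with (CB * CW * Rpower t s * Rpower t (2 * kappa))%R.
        * assert (P1 := Rpower_pos t (2 * kappa)).
          assert (CB * CW * Rpower t s * Rpower t (2 * kappa)
                  <= eps / 2 * Rpower t (2 * kappa))%R by (apply Rmult_le_compat_r; lra).
          lra.
        * unfold Rminus. rewrite !Rpower_plus, Rpower_Ropp, Rpower_1 by lra. field. lra. }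
  assert (Px := Rpower_pos x (2 * kappa + 1)).
  replace (v x / rpow (kappa + 1) x - m)
    with ((W x - m * rpow (2 * kappa + 1) x - 0) * / rpow (2 * kappa + 1) x).
  2: { replace (2 * kappa + 1)%R with (kappa + (kappa + 1))%R by ring.
       rewrite (rpow_plus kappa (kappa + 1)). unfold W. field.
       split; apply rpow_neq_0. }
  rewrite Cmod_mult, Cmod_inv, Cmod_rpow by apply rpow_neq_0.
  apply Rlt_div_l; [lra |]. apply Rle_lt_trans with (1 := F).
  apply Rmult_lt_compat_l; auto.
  apply Rlt_div_l; [lra |]. nra.
Qed.

(** The asymptotics of u' and v' need no new estimate: the equations are divided by x^(kappa-1) and
    x^kappa, and x q(x) tends to 0 because alpha + 1 > 0. *)
Lemma regular_of_bounds : regular_solution a kappa p1 p2 q r11 r12 r21 r22 lambda u v.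
Proof.
  assert (LU := Lu). assert (LV := v_limit).
  set (U := fun x => u x / rpow kappa x) in LU.
  set (V := fun x => v x / rpow (kappa + 1) x) in LV.
  assert (Lp1 := cont_on_at_right a p1 Ha Cp1).
  assert (Lp2 := cont_on_at_right a p2 Ha Cp2).
  assert (L11 := cont_on_at_right a r11 Ha Cr11).
  assert (L12 := cont_on_at_right a r12 Ha Cr12).
  assert (L21 := cont_on_at_right a r21 Ha Cr21).
  assert (L22 := cont_on_at_right a r22 Ha Cr22).
  assert (Lpow : forall y, (0 < y)%R ->
    filterlim (rpow y) (at_right 0) (locally (T := C_UniformSpace) (RtoC 0))).
  { intros y Hy. apply filterlim_RtoC; [typeclasses eauto |]. now apply filterlim_Rpower_0. }
  assert (Lx := Lpow 1%R Rlt_0_1).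
  set (Q := fun x => rpow 1 x * q x).
  assert (LQ : filterlim Q (at_right 0) (locally (T := C_UniformSpace) (RtoC 0))).
  { apply filterlim_0_dominated with (fun x => cq * Rpower x s)%R.
    - apply at_right_0_iff. exists a. split; auto. intros x Hx.
      unfold s. rewrite (Rplus_comm alpha), Rpower_plus.
      replace (cq * (Rpower x 1 * Rpower x alpha))%R
        with (Rpower x 1 * (cq * Rpower x alpha))%R by ring.
      apply Cmod_mult_le; [rewrite Cmod_rpow; apply Rle_refl |]. apply Bq. split; lra.
    - now apply filterlim_Rmult_0, filterlim_Rpower_0. }
  assert (Near : at_right 0 (Ioc a)).
  { apply at_right_0_iff. exists a. split; auto. intros x Hx. split; lra. }
  assert (Ldu : filterlim (fun x => rhs_u u v x / rpow (kappa - 1) x) (at_right 0)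
                  (locally (T := C_UniformSpace) (RtoC kappa))).
  { apply filterlim_ext_loc with (fun x => RtoC kappa * U x + (Q x * U x
      + rpow 1 x * (p2 x * (rpow 1 x * V x)
          + - (lambda * (r21 x * U x + r22 x * (rpow 1 x * V x)))))).
    - revert Near. apply filter_imp. intros x [Hx _].
      unfold U, V, Q, rhs_u, sigma, Rminus. rewrite !rpow_plus, rpow_opp, !rpow_1 by auto.
      rewrite RtoC_div by lra. field.
      split; first [apply rpow_neq_0 | intros Z; apply RtoC_inj in Z; lra].
    - eapply filterlim_C_eq; [Climit | ring]. }
  assert (Ldv : filterlim (fun x => rhs_v u v x / rpow kappa x) (at_right 0)
                  (locally (T := C_UniformSpace) (m * RtoC (kappa + 1)))).
  { apply filterlim_ext_loc with (fun x => - (p1 x * U x) + (- (RtoC kappa * V x)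
      + (- (Q x * V x) + lambda * (r11 x * U x + r12 x * (rpow 1 x * V x))))).
    - revert Near. apply filter_imp. intros x [Hx _].
      unfold U, V, Q, rhs_v, sigma. rewrite !rpow_plus, !rpow_1 by auto.
      rewrite RtoC_div by lra. field.
      split; first [apply rpow_neq_0 | intros Z; apply RtoC_inj in Z; lra].
    - eapply filterlim_C_eq; [Climit |].
      (* The limit obtained is A0 - kappa m with A0 = (2 kappa + 1) m. *)
      unfold m, mu. rewrite !RtoC_plus, RtoC_mult. field.
      intros Z. apply (f_equal Re) in Z. simpl in Z. lra. }
  destruct (cont_on_rhs u v (is_derive_on_cont_on _ _ _ Du) (is_derive_on_cont_on _ _ _ Dv))
    as [Cdu Cdv].
  exists (rhs_u u v), (rhs_v u v).
  split; [| split; [| split; [| split; [| split; [| split; [intros Nm; split | intros Zm; split]]]]]].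
  - split; [split; assumption | split; [split; assumption |]].
    intros x _. unfold rhs_u, rhs_v, sigma. split; ring.
  - apply filterlim_C_bounded with (RtoC 0).
    apply filterlim_ext with (fun x => rpow kappa x * U x).
    { intros x. unfold U. field. apply rpow_neq_0. }
    assert (Lk := Lpow kappa ltac:(lra)).
    eapply filterlim_C_eq; [Climit | ring].
  - apply filterlim_C_bounded with (RtoC 0).
    apply filterlim_ext with (fun x => rpow (kappa + 1) x * V x).
    { intros x. unfold V. field. apply rpow_neq_0. }
    assert (Lk := Lpow (kappa + 1)%R ltac:(lra)).
    eapply filterlim_C_eq; [Climit | ring].
  - replace (rpow kappa) with (fun x => 1 * rpow kappa x)
      by (apply functional_extensionality; intros; ring).
    apply asymp_of_limit; [exact C1_nz | apply rpow_neq_0 | exact Lu].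
  - apply asymp_of_limit; [| apply rpow_neq_0 | exact Ldu].
    intros Z. apply RtoC_inj in Z. lra.
  - apply asymp_of_limit; [assumption | apply rpow_neq_0 | exact v_limit].
  - apply asymp_of_limit; [| apply rpow_neq_0 | exact Ldv].
    apply Cmult_neq_0; auto. intros Z. apply RtoC_inj in Z. lra.
  - apply little_o_of_limit; [apply rpow_neq_0 |].
    apply filterlim_C_eq with m; [exact v_limit | assumption].
  - apply little_o_of_limit; [apply rpow_neq_0 |].
    apply filterlim_C_eq with (m * RtoC (kappa + 1)); [exact Ldv |].
    fold m in Zm. rewrite Zm. ring.
Qed.

End Asymptotics.

(** * Uniqueness: a solution with vanishing leading coefficients is zero *)

Section Vanishing.
Variables u v : R -> C.
Hypothesis Du : forall x, Ioc a x -> is_derive_on (Ioc a) u x (rhs_u u v x).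
Hypothesis Dv : forall x, Ioc a x -> is_derive_on (Ioc a) v x (rhs_v u v x).
Hypothesis Lu :
  filterlim (fun x => u x / rpow kappa x) (at_right 0) (locally (T := C_UniformSpace) (RtoC 0)).
Hypothesis Lv :
  filterlim (fun x => v x / rpow (kappa + 1) x) (at_right 0)
    (locally (T := C_UniformSpace) (RtoC 0)).

(** The integrating factors x^(-kappa) for u and x^kappa for v remove the singular terms, which have
    opposite signs. [b] puts v on the scale of u; it is not differentiated but recovered as x^(-2
    kappa) [psi]. *)
Let phi (x : R) : C := rpow (- kappa) x * u x.
Let b (x : R) : C := rpow (- kappa) x * v x.
Let psi (x : R) : C := rpow kappa x * v x.
Let dphi (x : R) : C := (q x + - (lambda * r21 x)) * phi x + (p2 x + - (lambda * r22 x)) * b x.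
Let dpsi (x : R) : C :=
  rpow (2 * kappa) x * ((- p1 x + lambda * r11 x) * phi x + (- q x + lambda * r12 x) * b x).

Let phi_derive (x : R) : Ioc a x -> is_derive_on (Ioc a) phi x (dphi x).
Proof.
  intros Hx.
  replace (dphi x)
    with (RtoC (- kappa / x) * rpow (- kappa) x * u x + rpow (- kappa) x * rhs_u u v x).
  - apply is_derive_on_mult; auto. apply is_derive_on_rpow; auto. apply Hx.
  - unfold dphi, phi, b, rhs_u, sigma. unfold Rdiv. rewrite Ropp_mult_distr_l_reverse.
    rewrite RtoC_opp. ring.
Qed.

Let psi_derive (x : R) : Ioc a x -> is_derive_on (Ioc a) psi x (dpsi x).
Proof.
  intros Hx.
  replace (dpsi x)
    with (RtoC (kappa / x) * rpow kappa x * v x + rpow kappa x * rhs_v u v x).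
  - apply is_derive_on_mult; auto. apply is_derive_on_rpow; auto. apply Hx.
  - unfold dpsi, phi, b, rhs_v, sigma.
    replace (2 * kappa)%R with (kappa + kappa)%R by ring.
    rewrite rpow_plus, rpow_opp. field. apply rpow_neq_0.
Qed.

Let Lpow (y : R) :
  (0 < y)%R -> filterlim (rpow y) (at_right 0) (locally (T := C_UniformSpace) (RtoC 0)).
Proof.
  intros Hy. apply filterlim_RtoC; [typeclasses eauto |]. now apply filterlim_Rpower_0.
Qed.

Let phi_0 : filterlim phi (at_right 0) (locally (T := C_UniformSpace) (RtoC 0)).
Proof.
  apply filterlim_ext with (2 := Lu). intros x. unfold phi. rewrite rpow_opp. apply Cmult_comm.
Qed.

Let b_0 : filterlim b (at_right 0) (locally (T := C_UniformSpace) (RtoC 0)).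
Proof.
  apply filterlim_ext with (fun x => rpow 1 x * (v x / rpow (kappa + 1) x)).
  - intros x. unfold b. rewrite rpow_opp, rpow_plus. field. split; apply rpow_neq_0.
  - assert (L1 := Lpow 1 Rlt_0_1). eapply filterlim_C_eq.
    + apply (filterlim_Cmult (at_right 0) (rpow 1)); [exact L1 | exact Lv].
    + ring.
Qed.

Let psi_0 : filterlim psi (at_right 0) (locally (T := C_UniformSpace) (RtoC 0)).
Proof.
  apply filterlim_ext with (fun x => rpow (2 * kappa) x * b x).
  - intros x. unfold psi, b. replace (2 * kappa)%R with (kappa + kappa)%R by ring.
    rewrite rpow_opp, rpow_plus. field. apply rpow_neq_0.
  - assert (L1 := Lpow (2 * kappa) ltac:(lra)). eapply filterlim_C_eq.
    + apply (filterlim_Cmult (at_right 0) (rpow (2 * kappa))); [exact L1 | exact b_0].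
    + ring.
Qed.

Let initial_bound :
  exists M, (0 <= M)%R /\ forall x, Ioc a x -> (Cmod (phi x) <= M)%R /\ (Cmod (b x) <= M)%R.
Proof.
  assert (Cpw := cont_on_Rpower a (- kappa)).
  destruct (bounded_on_Ioc a phi Ha) as [M1 [P1 B1]].
  { apply cont_on_mult; auto. exact (is_derive_on_cont_on _ _ _ Du). }
  { exact (filterlim_C_bounded _ _ phi_0). }
  destruct (bounded_on_Ioc a b Ha) as [M2 [P2 B2]].
  { apply cont_on_mult; auto. exact (is_derive_on_cont_on _ _ _ Dv). }
  { exact (filterlim_C_bounded _ _ b_0). }
  exists (M1 + M2)%R. split; [lra |]. intros x Hx.
  specialize (B1 x Hx). specialize (B2 x Hx). lra.
Qed.

(* [phi' = O(w (|phi| + |b|))] and [x^(-2 kappa) psi' = O(w (|phi| + |b|))] with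
   the integrable weight [w = x^alpha]; integrating [n] times gives the bound. *)
Let iterated_bound :
  exists M N, forall n x, Ioc a x ->
    (Cmod (phi x) <= M * N ^ n * hpow s n x)%R /\ (Cmod (b x) <= M * N ^ n * hpow s n x)%R.
Proof.
  destruct initial_bound as [M [HM BM]]. destruct coefficient_bound as [K [HK BK]].
  set (N := (K + Cmod lambda * K)%R).
  assert (HN : (0 <= N)%R).
  { unfold N. generalize (Rmult_le_pos _ K (Cmod_ge_0 lambda) ltac:(lra)). lra. }
  (* Each derivative contains both [phi] and [b], each with a coefficient of size N x^alpha; hence
     the factor 2. *)
  exists M, (2 * N)%R. induction n as [| n IH]; intros x Hx.
  - rewrite hpow_0, pow_O, !Rmult_1_r. now apply BM.
  - set (B := (M * (2 * N) ^ n)%R) in *.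
    assert (HB : (0 <= B)%R) by (apply Rmult_le_pos; auto; apply pow_le; lra).
    assert (Sub : forall t, (0 < t <= x)%R -> Ioc a t) by (destruct Hx; intros; split; lra).
    assert (E : forall t, (2 * N * B * (Rpower t (s - 1) * hpow s n t)
      = N * Rpower t (s - 1) * (B * hpow s n t) + N * Rpower t (s - 1) * (B * hpow s n t))%R).
    { intros t. ring. }
    assert (BN : forall t r1 r2, Ioc a t -> (Cmod r1 <= K * Rpower t (s - 1))%R ->
      (Cmod r2 <= K * Rpower t (s - 1))%R ->
      (Cmod (r1 + lambda * r2) <= N * Rpower t (s - 1))%R).
    { intros t r1 r2 Ht H1 H2. unfold N. rewrite Rmult_plus_distr_r, Rmult_assoc.
      apply Cmod_plus_le; auto. apply Cmod_mult_le; auto. apply Rle_refl. }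
    assert (Dh : forall c t, (0 < t)%R -> is_derive (fun y => c * hpow s (S n) y)%R t
                  (c * (Rpower t (s - 1) * hpow s n t))%R).
    { intros c t Ht. apply is_derive_scal. now apply is_derive_hpow. }
    assert (Lh : forall c, filterlim (fun y => c * hpow s (S n) y)%R (at_right 0) (locally 0%R)).
    { intros c. now apply filterlim_Rmult_0, filterlim_hpow_0. }
    replace (M * (2 * N) ^ S n)%R with (2 * N * B)%R by (unfold B; simpl; ring).
    split.
    + replace (phi x) with (phi x - 0) by ring.
      apply (mean_value_inequality_0 a x phi dphi _ _ 0 x phi_derive
        (Dh (2 * N * B)%R) phi_0 (Lh (2 * N * B)%R)); try apply Hx.
      * intros t Ht. specialize (Sub t Ht). destruct (IH t Sub).
        destruct (BK t Sub) as [K1 [K2 [K3 [K4 [K5 [K6 K7]]]]]].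
        rewrite E. unfold dphi.
        replace (q t + - (lambda * r21 t)) with (q t + lambda * (- r21 t)) by ring.
        replace (p2 t + - (lambda * r22 t)) with (p2 t + lambda * (- r22 t)) by ring.
        apply Cmod_plus_le; apply Cmod_mult_le; auto; apply BN; auto; now rewrite Cmod_opp.
      * split; [apply Hx | apply Rle_refl].
    + assert (P2 := Rpower_pos x (2 * kappa)).
      (* The factor t^(2 kappa) of [dpsi] is at most x^(2 kappa), exactly what the passage from
         [psi] to [b] divides by. *)
      assert (Q : (Cmod (psi x - 0)
                   <= Rpower x (2 * kappa) * (2 * N * B) * hpow s (S n) x)%R).
      { apply (mean_value_inequality_0 a x psi dpsi _ _ 0 x psi_derive
          (Dh (Rpower x (2 * kappa) * (2 * N * B))%R) psi_0
          (Lh (Rpower x (2 * kappa) * (2 * N * B))%R)); try apply Hx.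
        - intros t Ht. specialize (Sub t Ht). destruct (IH t Sub).
          destruct (BK t Sub) as [K1 [K2 [K3 [K4 [K5 [K6 K7]]]]]].
          rewrite (Rmult_assoc (Rpower x (2 * kappa))), E. unfold dpsi.
          apply Cmod_mult_le.
          + rewrite Cmod_rpow. apply Rle_Rpower_l; lra.
          + apply Cmod_plus_le; apply Cmod_mult_le; auto; apply BN; auto; now rewrite Cmod_opp.
        - split; [apply Hx | apply Rle_refl]. }
      replace (b x) with ((psi x - 0) * rpow (- (2 * kappa)) x).
      2: { unfold psi, b. replace (2 * kappa)%R with (kappa + kappa)%R by ring.
           rewrite !rpow_opp, rpow_plus. field. apply rpow_neq_0. }
      rewrite Cmod_mult, Cmod_rpow, Rpower_Ropp.
      apply Rle_div_l; [lra |]. lra.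
Qed.

Lemma vanishing_solution (x : R) : Ioc a x -> u x = 0 /\ v x = 0.
Proof.
  intros Hx. destruct iterated_bound as [M [N B]].
  assert (L : is_lim_seq (fun n => M * N ^ n * hpow s n x)%R 0).
  { set (y := (N * (Rpower x s / s))%R).
    apply (is_lim_seq_ext (fun n => M * (pow_n y n * / INR (fact n)))%R).
    { intros n. rewrite pow_n_pow. unfold y, hpow. rewrite Rpow_mult_distr. field.
      apply INR_fact_neq_0. }
    replace 0%R with (M * 0)%R by ring. apply (is_lim_seq_scal_l _ M 0%R).
    apply (ex_series_lim_0 (fun n => pow_n y n * / INR (fact n))%R).
    exists (exp y). exact (is_exp_Reals y). }
  assert (Z : forall z, (forall n, Cmod z <= M * N ^ n * hpow s n x)%R -> z = 0).
  { intros z Hz. apply Cmod_eq_0, Rle_antisym; [| apply Cmod_ge_0].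
    apply (is_lim_seq_le (fun _ => Cmod z) _ (Cmod z) 0%R Hz); [apply is_lim_seq_const | exact L]. }
  assert (Nz := rpow_neq_0 kappa x).
  replace (u x) with (rpow kappa x * phi x).
  2: { unfold phi. rewrite rpow_opp. field. auto. }
  replace (v x) with (rpow kappa x * b x).
  2: { unfold b. rewrite rpow_opp. field. auto. }
  rewrite (Z (phi x) (fun n => proj1 (B n x Hx))), (Z (b x) (fun n => proj2 (B n x Hx))).
  split; ring.
Qed.

End Vanishing.

(** Both readings of the condition on v say that v / x^(kappa+1) tends to mu, with mu = 0 in the
    second. In the difference of two solutions the leading coefficients 1 and mu therefore
    cancel. *)
Lemma regular_solution_unique (u1 v1 u2 v2 : R -> C) (x : R) :
  regular_solution a kappa p1 p2 q r11 r12 r21 r22 lambda u1 v1 ->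
  regular_solution a kappa p1 p2 q r11 r12 r21 r22 lambda u2 v2 ->
  Ioc a x -> u1 x = u2 x /\ v1 x = v2 x.
Proof.
  set (m := mu kappa p1 r11 lambda).
  assert (Lim : forall u v, regular_solution a kappa p1 p2 q r11 r12 r21 r22 lambda u v ->
    (forall x, Ioc a x -> is_derive_on (Ioc a) u x (rhs_u u v x)) /\
    (forall x, Ioc a x -> is_derive_on (Ioc a) v x (rhs_v u v x)) /\
    filterlim (fun x => u x / rpow kappa x) (at_right 0) (locally (T := C_UniformSpace) (RtoC 1)) /\
    filterlim (fun x => v x / rpow (kappa + 1) x) (at_right 0) (locally (T := C_UniformSpace) m)).
  { intros u v [du [dv [[[Du _] [[Dv _] Eq]] [_ [_ [Au [_ [Av0 Av1]]]]]]]].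
    split; [| split; [| split]].
    - intros y Hy. replace (rhs_u u v y) with (du y); [now apply Du |].
      destruct (Eq y Hy) as [_ E]. unfold rhs_u, sigma. rewrite <- E. ring.
    - intros y Hy. replace (rhs_v u v y) with (dv y); [now apply Dv |].
      destruct (Eq y Hy) as [E _]. unfold rhs_v, sigma. rewrite <- E. ring.
    - apply limit_of_asymp; [apply rpow_neq_0 |].
      replace (fun x => 1 * rpow kappa x) with (rpow kappa); [exact Au |].
      apply functional_extensionality. intros y. ring.
    - destruct (Ceq_dec m 0) as [E | N].
      + rewrite E. apply limit_of_little_o; [apply rpow_neq_0 |]. now apply Av1.
      + apply limit_of_asymp; [apply rpow_neq_0 |]. now apply Av0. }
  intros H1 H2 Hx. destruct (Lim _ _ H1) as [Du1 [Dv1 [Lu1 Lv1]]].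
  destruct (Lim _ _ H2) as [Du2 [Dv2 [Lu2 Lv2]]].
  destruct (vanishing_solution (fun y => u1 y - u2 y) (fun y => v1 y - v2 y)) with x
    as [Eu Ev]; auto.
  - intros y Hy.
    replace (rhs_u _ _ y) with (rhs_u u1 v1 y - rhs_u u2 v2 y) by (unfold rhs_u; ring).
    apply is_derive_on_minus; auto.
  - intros y Hy.
    replace (rhs_v _ _ y) with (rhs_v u1 v1 y - rhs_v u2 v2 y) by (unfold rhs_v; ring).
    apply is_derive_on_minus; auto.
  - apply filterlim_ext with (fun y => u1 y / rpow kappa y + - (u2 y / rpow kappa y)).
    { intros y. unfold Cdiv. ring. }
    eapply filterlim_C_eq; [Climit | ring].
  - apply filterlim_ext with (fun y => v1 y / rpow (kappa + 1) y + - (v2 y / rpow (kappa + 1) y)).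
    { intros y. unfold Cdiv. ring. }
    eapply filterlim_C_eq; [Climit | ring].
  - split.
    + replace (u1 x) with (u1 x - u2 x + u2 x) by ring. rewrite Eu. ring.
    + replace (v1 x) with (v1 x - v2 x + v2 x) by ring. rewrite Ev. ring.
Qed.

(** * The two applications of the perturbation series *)

Lemma XYq_XY (n : nat) :
  XYq kappa p1 p2 q n =
  XY (f0 kappa) (g0 kappa p1) (fun _ => 0) (fun _ => 0) (fun x => - q x) (fun x => - q x)
    (fun x => - p2 x) n.
Proof.
  induction n as [| n IH]; [reflexivity |].
  cbn [XYq XY]. rewrite <- IH. destruct (XYq kappa p1 p2 q n) as [U V].
  assert (E1 : (fun t => - U t * g0 kappa p1 t * q t
                  + V t * (- f0 kappa t * q t - g0 kappa p1 t * p2 t))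
    = (fun t => U t * (f0 kappa t * 0 + g0 kappa p1 t * - q t)
                  + V t * (f0 kappa t * - q t + g0 kappa p1 t * - p2 t))).
  { apply functional_extensionality. intros t. ring. }
  (* With 0 in place of p2 the term containing Z is zero, so any Z may be inserted. *)
  assert (E2 : forall Z : R -> C,
    (fun t => q t / f0 kappa t * U t + p2 t / f0 kappa t * V t)
    = (fun t => - (- q t / f0 kappa t) * U t - - p2 t / f0 kappa t * V t
                  + 0 / (f0 kappa t * f0 kappa t) * Z t)).
  { intros Z. apply functional_extensionality. intros t. unfold Cdiv. ring. }
  rewrite E1. now rewrite <- E2.
Qed.

Let limit_of_bound (h : R -> C) (M : R) :
  (forall x, Ioc a x -> (Cmod (h x) <= M * (Rpower x kappa * hpow s 1 x))%R) ->
  filterlim (fun x => h x / rpow kappa x) (at_right 0) (locally (T := C_UniformSpace) (RtoC 0)).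
Proof.
  intros B. apply filterlim_0_dominated with (fun x => M * hpow s 1 x)%R.
  - apply at_right_0_iff. exists a. split; auto. intros x Hx.
    rewrite Cmod_div, Cmod_rpow by apply rpow_neq_0.
    assert (P1 := Rpower_pos x kappa). apply Rle_div_l; auto.
    rewrite Rmult_assoc, (Rmult_comm (hpow s 1 x)). apply B. split; lra.
  - now apply filterlim_Rmult_0, filterlim_hpow_0.
Qed.

(** With 0 in place of p2 the unperturbed system is triangular: f0 = x^kappa solves the first
    equation alone, and g0 follows by one integration with integrating factor x^kappa. *)
Lemma g0_derive_bound :
  (forall x, Ioc a x ->
     is_derive_on (Ioc a) (g0 kappa p1) x
       (- (p1 x * f0 kappa x) - RtoC (kappa / x) * g0 kappa p1 x)) /\
  exists M, (0 <= M)%R /\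
    forall x, Ioc a x -> (Cmod (g0 kappa p1 x) <= M * Rpower x kappa)%R.
Proof.
  destruct (bounded_on_Icc a p1 Ha Cp1) as [C1 [M [HM BM]]].
  set (F := fun t => rpow (2 * kappa) t * p1 t).
  set (G := fun t => (M * (Rpower t (2 * kappa + 1) / (2 * kappa + 1)))%R).
  set (dG := fun t => (M * Rpower t (2 * kappa))%R).
  assert (CF : cont_on (Ioc a) F) by (apply cont_on_mult; auto; apply cont_on_Rpower).
  assert (DG : forall t, (0 < t)%R -> is_derive G t (dG t)).
  { intros t Ht. apply is_derive_scal, is_derive_Rpower_S; lra. }
  assert (LG : filterlim G (at_right 0) (locally 0%R)).
  { apply filterlim_Rmult_0.
    apply (filterlim_ext (fun y => / (2 * kappa + 1) * Rpower y (2 * kappa + 1))%R).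
    { intros y. apply Rmult_comm. }
    apply filterlim_Rmult_0, filterlim_Rpower_0. lra. }
  assert (BF : forall t, Ioc a t -> (Cmod (F t) <= dG t)%R).
  { intros t Ht. unfold dG. rewrite Rmult_comm. apply Cmod_mult_le; auto.
    rewrite Cmod_rpow. apply Rle_refl. }
  destruct (int0_dominated a F G dG Ha CF DG LG BF) as [DI LI].
  split.
  - intros x Hx.
    replace (- (p1 x * f0 kappa x) - RtoC (kappa / x) * g0 kappa p1 x)
      with ((- (1) * (RtoC (- kappa / x) * rpow (- kappa) x)) * int0 F x
            + (- (1) * rpow (- kappa) x) * F x).
    + apply is_derive_on_ext with (fun y => (- (1) * rpow (- kappa) y) * int0 F y); auto.
      { intros y _. unfold g0. fold F. ring. }
      apply is_derive_on_mult; auto. apply is_derive_on_scal; auto.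
      apply is_derive_on_rpow; auto. apply Hx.
    + unfold g0, f0. fold F. unfold F at 2.
      replace (2 * kappa)%R with (kappa + kappa)%R by ring.
      unfold Rdiv. rewrite Ropp_mult_distr_l_reverse, RtoC_opp, rpow_plus, rpow_opp.
      field. apply rpow_neq_0.
  - exists (M * a)%R. split; [nra |]. intros x Hx.
    assert (Q : (Cmod (int0 F x - 0) <= G x)%R).
    { apply (mean_value_inequality_0 a x (int0 F) F G dG 0 x DI DG LI LG); try apply Hx.
      - intros t Ht. apply BF. destruct Hx; split; lra.
      - split; [apply Hx | apply Rle_refl]. }
    unfold g0. fold F.
    replace (- rpow (- kappa) x * int0 F x) with (- (rpow (- kappa) x * (int0 F x - 0))) by ring.
    rewrite Cmod_opp, Cmod_mult, Cmod_rpow.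
    assert (P1 := Rpower_pos x kappa). assert (P2 := Rpower_pos x (- kappa)).
    apply Rle_trans with (Rpower x (- kappa) * G x)%R.
    { apply Rmult_le_compat_l; lra. }
    unfold G. replace (2 * kappa + 1)%R with (kappa + kappa + 1)%R at 1 by ring.
    rewrite Rpower_Ropp, !Rpower_plus, Rpower_1 by apply Hx.
    replace (/ Rpower x kappa * (M * (Rpower x kappa * Rpower x kappa * x / (2 * kappa + 1))))%R
      with (M * (x / (2 * kappa + 1)) * Rpower x kappa)%R by (field; lra).
    apply Rmult_le_compat_r; [lra |]. apply Rmult_le_compat_l; auto.
    destruct Hx. apply Rle_div_l; nra.
Qed.

Let f := fq kappa p1 p2 q.
Let g := gq kappa p1 p2 q.

(** The perturbation series at lambda = 1 over (f0, g0), with q and p2 moved to the right-hand side.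
    The last estimate is kept for the second use, where it gives f / x^kappa -> 1. *)
Lemma homogeneous_solution :
  (forall x, Ioc a x ->
     is_Cseries (fun n => / RtoC (INR (fact n)) * Xq kappa p1 p2 q n x) (f x) /\
     is_Cseries (fun n => / RtoC (INR (fact n)) * Yq kappa p1 p2 q n x) (g x)) /\
  (forall x, Ioc a x ->
     is_derive_on (Ioc a) f x (sigma x * f x + p2 x * g x) /\
     is_derive_on (Ioc a) g x (- (p1 x * f x) - sigma x * g x)) /\
  exists M, forall x, Ioc a x ->
    (Cmod (f x - rpow kappa x) <= M * (Rpower x kappa * hpow s 1 x))%R /\
    (Cmod (g x) <= M * Rpower x kappa)%R.
Proof.
  destruct coefficient_bound as [K1 [HK1 BK]]. destruct g0_derive_bound as [Dg0 [K2 [HK2 Bg0]]].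
  assert (C2 := proj1 (bounded_on_Icc a p2 Ha Cp2)).
  set (K := (K1 + K2)%R).
  assert (Up : forall x z, (Cmod z <= K1 * Rpower x (s - 1) ->
                           Cmod z <= K * Rpower x (s - 1))%R).
  { intros x z H. apply Rle_trans with (1 := H). unfold K.
    assert (P1 := Rpower_pos x (s - 1)). apply Rmult_le_compat_r; lra. }
  assert (B0 : forall x, (Cmod 0 <= K * Rpower x (s - 1))%R).
  { intros x. rewrite Cmod_0. apply Rmult_le_pos; [unfold K; lra |]. left. apply Rpower_pos. }
  assert (Hk0 : (0 <= kappa)%R) by lra. assert (HK : (1 <= K)%R) by (unfold K; lra).
  assert (Df0 : forall x, Ioc a x -> is_derive_on (Ioc a) (f0 kappa) x
    (RtoC (kappa / x) * f0 kappa x + 0 * g0 kappa p1 x)).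
  { intros x Hx.
    replace (RtoC (kappa / x) * f0 kappa x + 0 * g0 kappa p1 x)
      with (RtoC (kappa / x) * rpow kappa x) by (unfold f0; ring).
    apply is_derive_on_rpow; auto. apply Hx. }
  assert (Cq' : cont_on (Ioc a) (fun x => - q x)) by now apply cont_on_opp.
  assert (Cp2' : cont_on (Ioc a) (fun x => - p2 x)) by now apply cont_on_opp.
  assert (C0 := cont_on_const (Ioc a) 0).
  assert (Bf0 : forall x, Ioc a x -> (Cmod (f0 kappa x) <= K * Rpower x kappa)%R).
  { intros x Hx. unfold f0. rewrite Cmod_rpow. assert (P1 := Rpower_pos x kappa). nra. }
  assert (Bif0 : forall x, Ioc a x -> (Cmod (/ f0 kappa x) <= K / Rpower x kappa)%R).
  { intros x Hx. unfold f0. rewrite Cmod_inv, Cmod_rpow by apply rpow_neq_0.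
    assert (P1 := Rinv_0_lt_compat _ (Rpower_pos x kappa)). unfold Rdiv. nra. }
  assert (Bg0' : forall x, Ioc a x -> (Cmod (g0 kappa p1 x) <= K * Rpower x kappa)%R).
  { intros x Hx. apply Rle_trans with (1 := Bg0 x Hx).
    assert (P1 := Rpower_pos x kappa). apply Rmult_le_compat_r; unfold K; lra. }
  assert (Bq' : forall x, Ioc a x -> (Cmod (- q x) <= K * Rpower x (s - 1))%R).
  { intros x Hx. rewrite Cmod_opp. apply Up. exact (proj1 (BK x Hx)). }
  assert (Bp2' : forall x, Ioc a x -> (Cmod (- p2 x) <= K * Rpower x (s - 1))%R).
  { intros x Hx. rewrite Cmod_opp. apply Up. exact (proj1 (proj2 (proj2 (BK x Hx)))). }
  assert (coef : forall n z, / RtoC (INR (fact n)) * z = Cpow 1 n / RtoC (INR (fact n)) * z).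
  { intros n z. unfold Cdiv. rewrite Cpow_1_l. ring. }
  assert (EX : forall x, (fun n => / RtoC (INR (fact n)) * Xq kappa p1 p2 q n x)
    = (fun n => Cpow 1 n / RtoC (INR (fact n)) *
        Xpow (f0 kappa) (g0 kappa p1) (fun _ => 0) (fun _ => 0) (fun x => - q x)
          (fun x => - q x) (fun x => - p2 x) n x)).
  { intros x. apply functional_extensionality. intros n. unfold Xq, Xpow.
    now rewrite XYq_XY, coef. }
  assert (EY : forall x, (fun n => / RtoC (INR (fact n)) * Yq kappa p1 p2 q n x)
    = (fun n => Cpow 1 n / RtoC (INR (fact n)) *
        Ypow (f0 kappa) (g0 kappa p1) (fun _ => 0) (fun _ => 0) (fun x => - q x)
          (fun x => - q x) (fun x => - p2 x) n x)).
  { intros x. apply functional_extensionality. intros n. unfold Yq, Ypow.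
    now rewrite XYq_XY, coef. }
  assert (Ef : forall x, f x = CSeries (fun n => Cpow 1 n / RtoC (INR (fact n)) *
        Xpow (f0 kappa) (g0 kappa p1) (fun _ => 0) (fun _ => 0) (fun x => - q x)
          (fun x => - q x) (fun x => - p2 x) n x)).
  { intros x. now rewrite <- EX. }
  assert (Eg : forall x, g x = CSeries (fun n => Cpow 1 n / RtoC (INR (fact n)) *
        Ypow (f0 kappa) (g0 kappa p1) (fun _ => 0) (fun _ => 0) (fun x => - q x)
          (fun x => - q x) (fun x => - p2 x) n x)).
  { intros x. now rewrite <- EY. }
  destruct (perturbed_system a s kappa K (fun x => RtoC (kappa / x)) p1 (fun _ => 0)
    (fun _ => 0) (fun x => - q x) (fun x => - q x) (fun x => - p2 x) (f0 kappa) (g0 kappa p1)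
    Ha Hs Hk0 HK C0 C0 Cq' Cq' Cp2' Df0 Dg0 (fun x _ => rpow_neq_0 kappa x) Bf0 Bif0 Bg0'
    (fun x _ => B0 x) (fun x _ => B0 x) Bq' Bq' Bp2' (RtoC 1) f g Ef Eg) as [S1 [S2 [M S3]]].
  split; [| split].
  - intros x Hx. rewrite EX, EY. exact (S1 x Hx).
  - intros x Hx. destruct (S2 x Hx) as [H1 H2]. split.
    + replace (sigma x * f x + p2 x * g x) with
        (RtoC (kappa / x) * f x + 0 * g x - 1 * (- q x * f x + - p2 x * g x)); [exact H1 |].
      unfold sigma. ring.
    + replace (- (p1 x * f x) - sigma x * g x) with
        (- (p1 x * f x) - RtoC (kappa / x) * g x + 1 * (0 * f x + - q x * g x)); [exact H2 |].
      unfold sigma. ring.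
  - exists M. exact S3.
Qed.

Lemma regular_solution_series :
  (forall x, Ioc a x -> f x <> 0) ->
  let u := fun x => CSeries (fun n =>
    Cpow lambda n / RtoC (INR (fact n)) * Xpow f g p2 r11 r12 r21 r22 n x) in
  let v := fun x => CSeries (fun n =>
    Cpow lambda n / RtoC (INR (fact n)) * Ypow f g p2 r11 r12 r21 r22 n x) in
  regular_solution a kappa p1 p2 q r11 r12 r21 r22 lambda u v /\
  forall x, Ioc a x ->
    is_Cseries (fun n =>
      Cpow lambda n / RtoC (INR (fact n)) * Xpow f g p2 r11 r12 r21 r22 n x) (u x) /\
    is_Cseries (fun n =>
      Cpow lambda n / RtoC (INR (fact n)) * Ypow f g p2 r11 r12 r21 r22 n x) (v x).
Proof.
  intros Nf u v.
  destruct homogeneous_solution as [_ [Dfg [M1 B1]]].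
  destruct coefficient_bound as [K1 [HK1 BK]].
  assert (Lf : filterlim (fun x => f x / rpow kappa x) (at_right 0)
                 (locally (T := C_UniformSpace) (RtoC 1))).
  { assert (L := limit_of_bound _ _ (fun x Hx => proj1 (B1 x Hx))). cbv beta in L.
    apply filterlim_ext with (fun x => (f x - rpow kappa x) / rpow kappa x + 1).
    { intros x. field. apply rpow_neq_0. }
    eapply filterlim_C_eq; [Climit | ring]. }
  assert (Cf : cont_on (Ioc a) f).
  { exact (is_derive_on_cont_on _ _ _ (fun x Hx => proj1 (Dfg x Hx))). }
  assert (Cpw := cont_on_Rpower a kappa).
  destruct (bounded_on_Ioc a (fun x => f x / rpow kappa x) Ha) as [K2 [HK2 B2]].
  { apply cont_on_div; auto. intros. apply rpow_neq_0. }
  { exact (filterlim_C_bounded _ _ Lf). }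
  (* Without zeros of f this inverse is continuous on (0,a], and near 0 it tends to 1; this gives
     the bound of 1/f by x^(-kappa). *)
  destruct (bounded_on_Ioc a (fun x => / (f x / rpow kappa x)) Ha) as [K3 [HK3 B3]].
  { apply cont_on_inv; [| apply cont_on_div; auto; intros; apply rpow_neq_0].
    intros x Hx. apply Cmult_neq_0; auto. rewrite <- rpow_opp. apply rpow_neq_0. }
  { apply filterlim_C_bounded with (/ 1).
    apply filterlim_Cinv; [typeclasses eauto | exact C1_nz | exact Lf]. }
  set (K := (K1 + K2 + K3 + Rabs M1)%R).
  assert (HM1 := Rabs_pos M1).
  assert (Up : forall x z, (Cmod z <= K1 * Rpower x (s - 1) ->
                           Cmod z <= K * Rpower x (s - 1))%R).
  { intros x z H. apply Rle_trans with (1 := H). unfold K.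
    assert (P1 := Rpower_pos x (s - 1)). apply Rmult_le_compat_r; lra. }
  assert (Hk0 : (0 <= kappa)%R) by lra. assert (HK : (1 <= K)%R) by (unfold K; lra).
  assert (Bf : forall x, Ioc a x -> (Cmod (f x) <= K * Rpower x kappa)%R).
  { intros x Hx. replace (f x) with (f x / rpow kappa x * rpow kappa x).
    2: { field. apply rpow_neq_0. }
    assert (P1 := Rpower_pos x kappa).
    apply Rle_trans with (K2 * Rpower x kappa)%R.
    + apply Cmod_mult_le; auto. rewrite Cmod_rpow. apply Rle_refl.
    + apply Rmult_le_compat_r; unfold K; lra. }
  assert (Bif : forall x, Ioc a x -> (Cmod (/ f x) <= K / Rpower x kappa)%R).
  { intros x Hx. replace (/ f x) with (/ (f x / rpow kappa x) * / rpow kappa x).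
    2: { field. split; [exact (Nf x Hx) | apply rpow_neq_0]. }
    assert (P1 := Rinv_0_lt_compat _ (Rpower_pos x kappa)).
    apply Rle_trans with (K3 * / Rpower x kappa)%R.
    + apply Cmod_mult_le; auto. rewrite Cmod_inv, Cmod_rpow by apply rpow_neq_0. apply Rle_refl.
    + apply Rmult_le_compat_r; unfold K; lra. }
  assert (Bg : forall x, Ioc a x -> (Cmod (g x) <= K * Rpower x kappa)%R).
  { intros x Hx. apply Rle_trans with (1 := proj2 (B1 x Hx)).
    assert (P1 := Rpower_pos x kappa). assert (P2 := Rle_abs M1).
    apply Rmult_le_compat_r; unfold K; lra. }
  assert (BK' : forall x, Ioc a x ->
    (Cmod (p2 x) <= K * Rpower x (s - 1))%R /\
    (Cmod (r11 x) <= K * Rpower x (s - 1))%R /\ (Cmod (r12 x) <= K * Rpower x (s - 1))%R /\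
    (Cmod (r21 x) <= K * Rpower x (s - 1))%R /\ (Cmod (r22 x) <= K * Rpower x (s - 1))%R).
  { intros x Hx. destruct (BK x Hx) as [_ [_ [H2 [H3 [H4 [H5 H6]]]]]].
    repeat split; apply Up; assumption. }
  destruct (perturbed_system a s kappa K sigma p1 p2 r11 r12 r21 r22 f g Ha Hs Hk0 HK
    (proj1 (bounded_on_Icc a p2 Ha Cp2)) (proj1 (bounded_on_Icc a r11 Ha Cr11))
    (proj1 (bounded_on_Icc a r12 Ha Cr12)) (proj1 (bounded_on_Icc a r21 Ha Cr21))
    (proj1 (bounded_on_Icc a r22 Ha Cr22))
    (fun x Hx => proj1 (Dfg x Hx)) (fun x Hx => proj2 (Dfg x Hx)) Nf Bf Bif Bg
    (fun x Hx => proj1 (BK' x Hx)) (fun x Hx => proj1 (proj2 (BK' x Hx)))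
    (fun x Hx => proj1 (proj2 (proj2 (BK' x Hx))))
    (fun x Hx => proj1 (proj2 (proj2 (proj2 (BK' x Hx)))))
    (fun x Hx => proj2 (proj2 (proj2 (proj2 (BK' x Hx)))))
    lambda u v (fun x => eq_refl) (fun x => eq_refl)) as [S1 [S2 [M S3]]].
  split; [| exact S1].
  apply regular_of_bounds.
  - intros x Hx. exact (proj1 (S2 x Hx)).
  - intros x Hx. exact (proj2 (S2 x Hx)).
  (* u / x^kappa is split into (u - f) / x^kappa, which tends to 0 by the surplus factor h, and f /
     x^kappa, which tends to 1. *)
  - assert (L := limit_of_bound _ _ (fun x Hx => proj1 (S3 x Hx))). cbv beta in L.
    apply filterlim_ext with (fun x => (u x - f x) / rpow kappa x + f x / rpow kappa x).
    { intros x. field. apply rpow_neq_0. }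
    eapply filterlim_C_eq; [Climit | ring].
  - exists M. intros x Hx. exact (proj2 (S3 x Hx)).
Qed.

End System.

Local Close Scope C_scope.

Theorem theorem2p11 :
  forall (a kappa : R) (p1 p2 r11 r12 r21 r22 : R -> C) (lambda : C)
         (q : R -> C) (cq alpha : R),
    (0 < a)%R -> (1 / 2 <= kappa)%R ->
    cont_on (Icc a) p1 -> cont_on (Icc a) p2 ->
    cont_on (Icc a) r11 -> cont_on (Icc a) r12 ->
    cont_on (Icc a) r21 -> cont_on (Icc a) r22 ->
    p1 0%R <> RtoC 0 ->
    cont_on (Ioc a) q ->
    (0 < cq)%R -> (-1 < alpha <= 0)%R ->
    (forall x : R, Ioc a x -> (Cmod (q x) <= cq * Rpower x alpha)%R) ->
    let f := fq kappa p1 p2 q in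
    let g := gq kappa p1 p2 q in
    (forall x : R, Ioc a x -> f x <> RtoC 0) ->
    (solves_homogeneous a kappa p1 p2 q f g /\
     forall x : R, Ioc a x ->
       is_Cseries (fun n => / RtoC (INR (fact n)) * Xq kappa p1 p2 q n x)%C (f x) /\
       is_Cseries (fun n => / RtoC (INR (fact n)) * Yq kappa p1 p2 q n x)%C (g x)) /\
    exists u v : R -> C,
      regular_solution a kappa p1 p2 q r11 r12 r21 r22 lambda u v /\
      (forall u1 v1 : R -> C,
         regular_solution a kappa p1 p2 q r11 r12 r21 r22 lambda u1 v1 ->
         forall x : R, Ioc a x -> u1 x = u x /\ v1 x = v x) /\
      (forall x : R, Ioc a x ->
         is_Cseries (fun n => Cpow lambda n / RtoC (INR (fact n)) *
                       Xpow f g p2 r11 r12 r21 r22 n x)%C (u x) /\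
         is_Cseries (fun n => Cpow lambda n / RtoC (INR (fact n)) *
                       Ypow f g p2 r11 r12 r21 r22 n x)%C (v x)).
Proof.
  intros a kappa p1 p2 r11 r12 r21 r22 lambda q cq alpha Ha Hkappa Cp1 Cp2 Cr11 Cr12 Cr21 Cr22
    _ Cq Hcq Halpha Bq f g Nf.
  destruct (homogeneous_solution a kappa alpha cq p1 p2 r11 r12 r21 r22 q Ha Hkappa
    Cp1 Cp2 Cr11 Cr12 Cr21 Cr22 Cq Hcq Halpha Bq) as [Sfg [Dfg _]].
  destruct (regular_solution_series a kappa alpha cq p1 p2 r11 r12 r21 r22 q lambda Ha Hkappa
    Cp1 Cp2 Cr11 Cr12 Cr21 Cr22 Cq Hcq Halpha Bq Nf) as [Reg Suv].
  fold f g in Sfg, Dfg, Reg, Suv.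
  split; [split; [| exact Sfg] |].
  - assert (Cf : cont_on (Ioc a) f)
      by exact (is_derive_on_cont_on _ _ _ (fun x Hx => proj1 (Dfg x Hx))).
    assert (Cg : cont_on (Ioc a) g)
      by exact (is_derive_on_cont_on _ _ _ (fun x Hx => proj2 (Dfg x Hx))).
    assert (Cs := cont_on_sigma a kappa q Cq).
    assert (C1 := proj1 (bounded_on_Icc a p1 Ha Cp1)).
    assert (C2 := proj1 (bounded_on_Icc a p2 Ha Cp2)).
    exists (fun x => sigma kappa q x * f x + p2 x * g x)%C,
      (fun x => - (p1 x * f x) - sigma kappa q x * g x)%C.
    split; [split; [exact (fun x Hx => proj1 (Dfg x Hx)) | Ccontinuous] |].
    split; [split; [exact (fun x Hx => proj2 (Dfg x Hx)) | Ccontinuous] |].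
    intros x _. unfold sigma. split; ring.
  - eexists _, _. split; [exact Reg |]. split; [| exact Suv].
    intros u1 v1 H1 x Hx.
    exact (regular_solution_unique a kappa alpha cq p1 p2 r11 r12 r21 r22 q lambda Ha Hkappa
      Cp1 Cp2 Cr11 Cr12 Cr21 Cr22 Hcq Halpha Bq u1 v1 _ _ x H1 Reg Hx).
Qed.
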